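(* Let $\Omega\subseteq\mathbb{R}^N$ be a nonempty open set, let $0<m<1$, let $\mathbb{A}=\mathbb{C}\setminus\{z\in\mathbb{C};\ \mathrm{Re}(z)\le0\text{ and }\mathrm{Im}(z)=0\}$, and let $(a,b)\in\mathbb{A}\times\mathbb{A}$ satisfy $$\mathrm{Im}(a)\mathrm{Im}(b)\ge0,\qquad\text{or}\qquad \Big(\mathrm{Im}(a)\mathrm{Im}(b)<0\ \text{ and }\ \mathrm{Re}(b)>\frac{\mathrm{Im}(b)}{\mathrm{Im}(a)}\mathrm{Re}(a)\Big).$$ Let $F\in L^2(\Omega)$ and let $u\in H^1(\Omega)\cap L^{m+1}(\Omega)$ be any solution to $$-\Delta u+a|u|^{-(1-m)}u+bu=F\quad\text{in }L^2(\Omega)+L^{\frac{m+1}{m}}(\Omega)$$ with either the homogeneous Dirichlet boundary condition $u_{|\Gamma}=0$, or the homogeneous Neumann boundary condition $\frac{\partial u}{\partial\nu}_{|\Gamma}=0$ (in the Neumann case $\Omega$ is additionally assumed to have a $C^1$ boundary). Then $$\|u\|_{H^1(\Omega)}^2+\|u\|_{L^{m+1}(\Omega)}^{m+1}\le M\|F\|_{L^2(\Omega)}^2,$$ where $M=M(|a|,|b|)$.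
   Context: All functions are complex-valued; $\Gamma$ is the boundary of $\Omega$ and $\nu$ its outward unit normal. The expression $|u|^{-(1-m)}u$ is understood to be $0$ where $u=0$. The Laplacian is taken in the sense of distributions. The Dirichlet condition means $u\in H^1_0(\Omega)$. The Neumann condition is understood weakly: with $f(u)=a|u|^{-(1-m)}u+bu$, $$\mathrm{Re}\int_\Omega\nabla u\cdot\overline{\nabla v}\,dx+\mathrm{Re}\int_\Omega f(u)\overline v\,dx=\mathrm{Re}\int_\Omega F\overline v\,dx$$ for all $v\in H^1(\Omega)$ vanishing outside a bounded set (i.e. all $v\in H^1(\Omega)$ if $\Omega$ is bounded). The notation $M=M(p_1,\dots,p_n)$ means that the positive constant $M$ depends continuously and only on $p_1,\dots,p_n$.
   Formalization: The constant M is taken to depend continuously and only on the pair (a,b), not only on |a| and |b|, because for a=b=e^{it}, t→π, on a bounded interval no constant depending on the moduli alone can work. *)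

(* Defs.v *)
From HB Require Import structures.
From mathcomp Require Import all_boot all_order all_algebra.
From mathcomp Require Import all_classical all_reals all_analysis.
From mathcomp Require Export complex.

Set Implicit Arguments.
Unset Strict Implicit.
Unset Printing Implicit Defensive.
Import Order.TTheory GRing.Theory Num.Theory.
Import numFieldNormedType.Exports.

Local Open Scope classical_set_scope.
Local Open Scope ring_scope.
Local Open Scope complex_scope.

(* R^n is 'rV[R]_n. Its measurable sets form the sigma-algebra generated by
   the coordinates, that is the Borel sigma-algebra. *)
Section measurable_rV.
Context {R : realType} (n : nat).

Definition rV_coord (i : 'I_n) (x : 'rV[R]_n) : R := x 0 i.

Let rV_set0 : g_sigma_preimage rV_coord set0.
Proof. exact: sigma_algebra0. Qed.

Let rV_setC A : g_sigma_preimage rV_coord A -> g_sigma_preimage rV_coord (~` A).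
Proof. exact: sigma_algebraC. Qed.

Let rV_bigcup (F : (set 'rV[R]_n)^nat) :
  (forall i, g_sigma_preimage rV_coord (F i)) ->
  g_sigma_preimage rV_coord (\bigcup_i (F i)).
Proof. exact: sigma_algebra_bigcup. Qed.

HB.instance Definition _ := @isMeasurable.Build default_measure_display
  'rV[R]_n (g_sigma_preimage rV_coord) rV_set0 rV_setC rV_bigcup.

Lemma measurable_rV_coord (i : 'I_n) :
  measurable_fun [set: 'rV[R]_n] (rV_coord i).
Proof.
move=> _ Y mY; rewrite setTI; apply: sub_sigma_algebra => /=.
rewrite -bigcup_seq/=; exists i => /=; first by rewrite mem_index_enum.
by exists Y => //; rewrite setTI.
Qed.

Lemma measurable_fun_rVP d (T : measurableType d) (f : T -> 'rV[R]_n) :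
  measurable_fun [set: T] f <->
  forall i, measurable_fun [set: T] (rV_coord i \o f).
Proof.
split=> [mf i|mf].
  by apply: measurableT_comp => //; exact: measurable_rV_coord.
have sub : g_sigma_preimage (fun i => rV_coord i \o f) `<=` measurable.
  apply: smallest_sub; first exact: sigma_algebra_measurable.
  rewrite -bigcup_seq; apply: bigcup_sub => i _ A [B mB <-]; exact: mf.
by rewrite g_sigma_preimage_comp in sub => _ A mA; apply: sub; exists A.
Qed.

End measurable_rV.

(* Lebesgue measure on R^n, by induction on n: the point mass on R^0, and on
   R^(n+1) the image of the product measure on R x R^n under (t, x) |-> t :: x. *)
Section lebesgue_rV.
Context {R : realType}.

Definition rV_cons n (p : measurableTypeR R * 'rV[R]_n) : 'rV[R]_n.+1 :=
  \row_i oapp (p.2 0) p.1 (unlift ord0 i).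

Lemma measurable_rV_cons n : measurable_fun setT (@rV_cons n).
Proof.
apply/measurable_fun_rVP => i; case: (unliftP ord0 i) => [j ->|->].
  rewrite (_ : _ \o _ = @rV_coord R n j \o snd).
    by apply: measurableT_comp => //; exact: measurable_rV_coord.
  by apply/funext => -[t x] /=; rewrite /rV_coord mxE liftK.
rewrite (_ : _ \o _ = fst); first exact: measurable_fst.
by apply/funext => -[t x] /=; rewrite /rV_coord mxE unlift_none.
Qed.

Section step.
Variables (n : nat) (m : {sigma_finite_measure set 'rV[R]_n -> \bar R}).

Definition lebesgue_rV_step : set 'rV[R]_n.+1 -> \bar R :=
  pushforward (@lebesgue_measure R \x m)%E (@rV_cons n).

HB.instance Definition _ := Measure.copy lebesgue_rV_step
  (measure_function_pushforward__canonical__measure_function_Measure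
     (@lebesgue_measure R \x m)%E (@measurable_rV_cons n)).

Let rV_uncons (x : 'rV[R]_n.+1) : measurableTypeR R * 'rV[R]_n :=
  (x 0 ord0, \row_i x 0 (lift ord0 i)).

Let rV_consK : cancel (@rV_cons n) rV_uncons.
Proof.
move=> [t x]; rewrite /rV_uncons /rV_cons !mxE unlift_none; congr pair.
by apply/rowP => i; rewrite !mxE liftK.
Qed.

Let measurable_rV_uncons : measurable_fun setT rV_uncons.
Proof.
apply/measurable_fun_pairP; split; first exact: measurable_rV_coord.
apply/measurable_fun_rVP => i.
rewrite (_ : _ \o _ = @rV_coord R n.+1 (lift ord0 i)).
  exact: measurable_rV_coord.
by apply/funext => x /=; rewrite /rV_coord mxE.
Qed.

Let lebesgue_rV_step_sigma_finite : sigma_finite setT lebesgue_rV_step.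
Proof.
have /sigma_finiteP[F [TF ndF Foo]] := sigma_finiteT (@lebesgue_measure R).
have /sigma_finiteP[G [TG ndG Goo]] := sigma_finiteT m.
exists (fun k => rV_uncons @^-1` (F k `*` G k)).
  rewrite -preimage_bigcup [X in _ @^-1` X](_ : _ = setT) ?preimage_setT//.
  rewrite -setXTT TF TG predeqE => -[x y]; split.
    by move=> [k _ []/= ? ?]; split; exists k.
  move=> [/= [k _ Fkx] [l _ Gly]]; exists (maxn k l) => //; split.
    by move: x Fkx; exact/subsetPset/ndF/leq_maxl.
  by move: y Gly; exact/subsetPset/ndG/leq_maxr.
move=> k; have [? ?] := Foo k; have [? ?] := Goo k; split.
  rewrite -[X in measurable X]setTI; apply: measurable_rV_uncons => //.
  exact: measurableX.
rewrite /lebesgue_rV_step /pushforward -comp_preimage.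
rewrite (_ : _ \o _ = id); last by apply/funext => p /=; rewrite rV_consK.
rewrite preimage_id product_measure1E//.
by rewrite lte_mul_pinfty// ge0_fin_numE.
Qed.

HB.instance Definition _ := Measure_isSigmaFinite.Build _ _ _
  lebesgue_rV_step lebesgue_rV_step_sigma_finite.
End step.

Fixpoint lebesgue_rV n : {sigma_finite_measure set 'rV[R]_n -> \bar R} :=
  if n is n'.+1 then lebesgue_rV_step (lebesgue_rV n') else \d_(0 : 'rV[R]_0).

End lebesgue_rV.

Section complex_functions.
Context {R : realType} {N : nat}.
Implicit Types (Omega : set 'rV[R]_N) (u g w phi : 'rV[R]_N -> R[i]).

Definition cmod (z : R[i]) : R := ComplexField.Normc.normc z.

Definition cintegral Omega u : R[i] :=
  (\int[lebesgue_rV N]_(x in Omega) complex.Re (u x)) +i*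
  (\int[lebesgue_rV N]_(x in Omega) complex.Im (u x)).

Definition cLnorm Omega (p : R) u : \bar R :=
  'N[lebesgue_rV N]_(p%:E)[(fun x => (cmod (u x))%:E) \_ Omega].

(* Functions are representatives of their almost-everywhere classes, and only
   their values on Omega matter. *)
Definition cLp Omega (p : R) : set ('rV[R]_N -> R[i]) :=
  [set u | [/\ measurable_fun Omega (fun x => complex.Re (u x)),
               measurable_fun Omega (fun x => complex.Im (u x)) &
               (cLnorm Omega p u < +oo)%E]].

Definition cLp_sum Omega (p q : R) : set ('rV[R]_N -> R[i]) :=
  [set w | exists w1 w2, [/\ cLp Omega p w1, cLp Omega q w2 &
     forall x, Omega x -> w x = w1 x + w2 x]].

(* C^oo: every iterated partial derivative exists everywhere and is continuous. *)
Definition iter_partial (s : seq 'I_N) (f : 'rV[R]_N -> R) : 'rV[R]_N -> R :=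
  foldr (fun i h x => 'D_('e_i) h x) f s.

Definition smooth (f : 'rV[R]_N -> R) : Prop :=
  forall s : seq 'I_N, continuous (iter_partial s f) /\
    forall (i : 'I_N) x, derivable (iter_partial s f) x 'e_i.

Definition cpartial (i : 'I_N) phi : 'rV[R]_N -> R[i] := fun x =>
  ('D_('e_i) (fun y => complex.Re (phi y)) x) +i*
  ('D_('e_i) (fun y => complex.Im (phi y)) x).

(* The complex-valued test functions C_c^oo(Omega). *)
Definition test_fun Omega : set ('rV[R]_N -> R[i]) :=
  [set phi | [/\ smooth (fun x => complex.Re (phi x)),
                 smooth (fun x => complex.Im (phi x)),
                 compact (closure [set x | phi x != 0]) &
                 closure [set x | phi x != 0] `<=` Omega]].

Definition weak_partial Omega (i : 'I_N) u g : Prop :=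
  forall phi, test_fun Omega phi ->
    cintegral Omega (fun x => u x * cpartial i phi x) =
    - cintegral Omega (fun x => g x * phi x).

Definition distr_laplacian Omega u w : Prop :=
  forall phi, test_fun Omega phi ->
    cintegral Omega (fun x => u x * \sum_(i < N) cpartial i (cpartial i phi) x) =
    cintegral Omega (fun x => w x * phi x).

(* H^1(Omega): a function bundled with its weak gradient, which is determined
   almost everywhere on Omega by the function. *)
Record H1 Omega := MkH1 {
  H1_fun :> 'rV[R]_N -> R[i];
  H1_grad : 'I_N -> 'rV[R]_N -> R[i];
  H1_L2 : cLp Omega 2 H1_fun;
  H1_grad_L2 : forall i, cLp Omega 2 (H1_grad i);
  H1_gradP : forall i, weak_partial Omega i H1_fun (H1_grad i) }.

Definition H1_norm Omega (u : H1 Omega) : \bar R :=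
  ((cLnorm Omega 2 u ^+ 2 + \sum_(i < N) cLnorm Omega 2 (H1_grad u i) ^+ 2)
     `^ (2^-1)%R)%E.

(* H^1_0(Omega), the closure of C_c^oo(Omega) in H^1(Omega); the weak gradient
   of a test function is its classical gradient. *)
Definition in_H10 Omega (u : H1 Omega) : Prop :=
  forall e : R, 0 < e -> exists2 phi, test_fun Omega phi &
    (cLnorm Omega 2 (fun x => u x - phi x)%R ^+ 2 +
     \sum_(i < N) cLnorm Omega 2 (fun x => H1_grad u i x - cpartial i phi x)%R ^+ 2
       < (e ^+ 2)%:E)%E.

Definition C1_fun n (f : 'rV[R]_n -> R) : Prop :=
  (forall x, differentiable f x) /\
  forall j : 'I_n, continuous (fun x => 'D_('e_j) f x).

(* Near each boundary point Omega is, for some coordinate i and up to the sign s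
   of that coordinate, the strict epigraph of a C^1 function of the other
   coordinates. *)
Definition C1_boundary Omega : Prop :=
  forall x, closure Omega x -> ~ interior Omega x ->
  exists (r : R) (i : 'I_N) (s : bool) (f : 'rV[R]_N.-1 -> R),
    [/\ 0 < r, C1_fun f &
        forall y, ball x r y ->
          (Omega y <-> f (col' i y) < (-1) ^+ s * y 0 i)].

End complex_functions.

Section schroedinger.
Context {R : realType} {N : nat}.
Implicit Types (Omega : set 'rV[R]_N) (a b : R[i]) (F : 'rV[R]_N -> R[i]).

(* At z = 0 the value is 0, because of the factor z. *)
Definition nonlin (m : R) a b (z : R[i]) : R[i] :=
  a * (cmod z `^ (- (1 - m)))%:C * z + b * z.

(* - Delta u + f(u) = F, where the distribution Delta u is (represented by) an
   element w of L^2(Omega) + L^((m+1)/m)(Omega). *)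
Definition solves Omega (m : R) a b F (u : H1 Omega) : Prop :=
  exists w, [/\ cLp_sum Omega 2 ((m + 1) / m) w,
    distr_laplacian Omega u w &
    {ae lebesgue_rV N, forall x, Omega x ->
       - w x + nonlin m a b (u x) = F x}].

Definition neumann Omega (m : R) a b F (u : H1 Omega) : Prop :=
  forall v : H1 Omega,
  (exists r : R, forall x, Omega x -> r < `|x| -> v x = 0) ->
  complex.Re (cintegral Omega
    (fun x => \sum_(i < N) H1_grad u i x * conjc (H1_grad v i x))) +
  complex.Re (cintegral Omega
    (fun x => nonlin m a b (u x) * conjc (v x))) =
  complex.Re (cintegral Omega (fun x => F x * conjc (v x))).

End schroedinger.

Section coefficients.
Context {R : realType}.

Definition slit_plane : set R[i] :=
  ~` [set z | complex.Re z <= 0 /\ complex.Im z = 0].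

Definition admissible (a b : R[i]) : Prop :=
  [/\ slit_plane a, slit_plane b &
    0 <= complex.Im a * complex.Im b \/
    (complex.Im a * complex.Im b < 0 /\
     complex.Im b / complex.Im a * complex.Re a < complex.Re b)].

End coefficients.

(* Main.v *)
Require Import Defs.
From mathcomp Require Import all_boot all_order all_algebra.
From mathcomp Require Import all_classical all_reals all_analysis.
From mathcomp Require Import complex measurable_realfun ring lra.

Set Implicit Arguments.
Unset Strict Implicit.
Unset Printing Implicit Defensive.
Import Order.TTheory GRing.Theory Num.Theory.
Import numFieldNormedType.Exports.

Local Open Scope classical_set_scope.
Local Open Scope ring_scope.

(** Multiplying the equation by the conjugate of [u] and integrating gives, with
    X the energy of the gradient, Y the integral of |u|^(m+1) and Z the energy
    of [u], the complex identity
      X + a Y + b Z = (integral of F times the conjugate of u)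
    ([energy_identity], [energy_densityE]). The hypothesis on (a, b) says exactly
    that 0 lies outside the triangle with vertices 1, a, b. If d > 0 is the
    distance from 0 to that triangle ([hull_gap]), then
    |X + a Y + b Z| >= d (X + Y + Z) for all nonnegative X, Y, Z, and Young's
    inequality on the right-hand side yields X + Y + Z <= (4 / d^2) |F|^2
    ([apriori_bound]). The constant 4 / d^2 depends on (a, b) only, and
    continuously so, because the distance is Lipschitz in the vertices.

    The work lies in justifying the multiplication when Omega has infinite
    measure: u itself cannot be used as a test function, since approximating it
    in H^1 by test functions says nothing about the integral of
    |u|^(m-1) u phi over an unbounded set. So the equation is multiplied by
    chi conj(u), for a smooth cut-off chi with bounded support and small
    gradient. On a set of finite measure |u|^m is in L^2, hence all the terms
    are pairings of L^2 functions, and the form [cut_form] obtained in this way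
    vanishes at u under either boundary condition. In the Dirichlet case it
    vanishes at every test function, by the equation, and it is continuous in
    H^1 ([cut_form_dirichlet]). In the Neumann case chi u and i chi u are
    admissible variations, which give its real and imaginary parts
    ([cut_form_neumann]). When chi = chi(s x) with s -> 0, the terms with the
    gradient of chi are O(s) and the others converge by dominated convergence.

    The cut-off is built from exp(1 - 1/t); that it is smooth in the sense of
    iterated partial derivatives follows from closing a class of functions under
    products, and under composition with a family of functions of one variable
    stable by derivation ([smooth_gen_smooth]). *)

(** * Modulus of a complex number *)

Section cmod_theory.
Context {R : realType}.
Implicit Types (z w : R[i]).
Local Notation Re := (@complex.Re R).
Local Notation Im := (@complex.Im R).

Lemma cReD z w : Re (z + w) = Re z + Re w. Proof. by case: z w => ? ? []. Qed.
Lemma cImD z w : Im (z + w) = Im z + Im w. Proof. by case: z w => ? ? []. Qed.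
Lemma cReN z : Re (- z) = - Re z. Proof. by case: z. Qed.
Lemma cImN z : Im (- z) = - Im z. Proof. by case: z. Qed.
Lemma cReM z w : Re (z * w) = Re z * Re w - Im z * Im w.
Proof. by case: z w => ? ? []. Qed.
Lemma cImM z w : Im (z * w) = Re z * Im w + Im z * Re w.
Proof. by case: z w => ? ? [] ? ? /=. Qed.
Lemma cRe_conj z : Re (conjc z) = Re z. Proof. by case: z. Qed.
Lemma cIm_conj z : Im (conjc z) = - Im z. Proof. by case: z. Qed.

Lemma eqc z w : Re z = Re w -> Im z = Im w -> z = w.
Proof. by case: z w => ? ? [] ? ? /= -> ->. Qed.

Definition cReImE := (cReD, cImD, cReN, cImN, cReM, cImM, cRe_conj, cIm_conj).

Lemma cmodE z : cmod z = Num.sqrt (Re z ^+ 2 + Im z ^+ 2).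
Proof. by case: z. Qed.

Lemma cmod_ge0 z : 0 <= cmod z. Proof. by rewrite cmodE sqrtr_ge0. Qed.

Lemma cmod_sqr z : cmod z ^+ 2 = Re z ^+ 2 + Im z ^+ 2.
Proof. by rewrite cmodE sqr_sqrtr// addr_ge0// sqr_ge0. Qed.

Lemma cmodM z w : cmod (z * w) = cmod z * cmod w.
Proof. exact: ComplexField.Normc.normcM. Qed.

Lemma cmodD_le z w : cmod (z + w) <= cmod z + cmod w.
Proof. by rewrite -lecR rmorphD; exact: (ler_normD z w). Qed.

Lemma cmod_norm (z : R[i]) : `|z| = ((cmod z)%:C)%C.
Proof. by []. Qed.

Lemma cmodN z : cmod (- z) = cmod z.
Proof. by rewrite !cmodE cReN cImN !sqrrN. Qed.

Lemma cmod_real (r : R) : cmod (r%:C)%C = `|r|.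
Proof. by rewrite cmodE/= expr0n addr0 sqrtr_sqr. Qed.

Lemma cmod_conj z : cmod (conjc z) = cmod z.
Proof. by rewrite !cmodE cRe_conj cIm_conj sqrrN. Qed.

Lemma normRe_le z : `|Re z| <= cmod z.
Proof. by rewrite cmodE -sqrtr_sqr ler_wsqrtr// lerDl sqr_ge0. Qed.

Lemma normIm_le z : `|Im z| <= cmod z.
Proof. by rewrite cmodE -sqrtr_sqr ler_wsqrtr// lerDr sqr_ge0. Qed.

Lemma cmod_le z : cmod z <= `|Re z| + `|Im z|.
Proof.
rewrite -(@ler_pXn2r _ 2) ?nnegrE ?cmod_ge0 ?addr_ge0// cmod_sqr.
rewrite -(real_normK (num_real (Re z))) -(real_normK (num_real (Im z))).
have := mulr_ge0 (normr_ge0 (Re z)) (normr_ge0 (Im z)); nra.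
Qed.

End cmod_theory.

(** * Distance from the origin to the triangle 1, a, b *)

Section gap.
Context {R : realType}.
Implicit Types (a b : R[i]).
Local Notation Re := (@complex.Re R).
Local Notation Im := (@complex.Im R).

(** The weights x, y, z run over the simplex, so this is the distance from 0 to
    the convex hull of 1, a and b. *)
Definition hull_gap a b : R :=
  inf [set r | exists x y z : R, [/\ 0 <= x, 0 <= y, 0 <= z, x + y + z = 1 &
    r = cmod ((x%:C)%C + a * (y%:C)%C + b * (z%:C)%C)]].

Lemma hull_gap_has_inf a b :
  has_inf [set r | exists x y z : R, [/\ 0 <= x, 0 <= y, 0 <= z, x + y + z = 1 &
    r = cmod ((x%:C)%C + a * (y%:C)%C + b * (z%:C)%C)]].
Proof.
split; last by exists 0 => _ [x [y [z [_ _ _ _ ->]]]]; exact: cmod_ge0.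
by exists (cmod ((1%:C)%C + a * (0%:C)%C + b * (0%:C)%C)), 1, 0, 0; split => //; lra.
Qed.

Lemma hull_gapP a b (x y z : R) : 0 <= x -> 0 <= y -> 0 <= z ->
  hull_gap a b * (x + y + z) <= cmod ((x%:C)%C + a * (y%:C)%C + b * (z%:C)%C).
Proof.
move=> x0 y0 z0; set s := x + y + z.
have [s0|s0] := eqVneq s 0; first by rewrite s0 mulr0 cmod_ge0.
have sp : 0 < s by rewrite lt_def s0/= !addr_ge0.
rewrite -ler_pdivlMr//; apply: ge_inf; first exact: (hull_gap_has_inf a b).2.
exists (x / s), (y / s), (z / s); split; rewrite ?divr_ge0 ?(ltW sp)//.
  by rewrite -!mulrDl divff.
have sv : s^-1 = cmod ((s^-1)%:C)%C by rewrite cmod_real ger0_norm// invr_ge0 ltW.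
rewrite [X in _ * X = _]sv -cmodM; congr cmod.
by apply: eqc; rewrite !cReImE/=; ring.
Qed.

(** Admissibility as strict separation: a half-plane
    Re z + l Im z > 0, which always contains 1, also contains a and b. If Im a
    and Im b have the same sign, any l large enough with that sign will do. If
    the signs are opposite, l must lie strictly between - Re a / Im a and
    - Re b / Im b, and the second admissibility condition says that these two
    bounds are in the right order. *)
Lemma admissible_halfplane a b : admissible a b ->
  exists l : R, 0 < Re a + l * Im a /\ 0 < Re b + l * Im b.
Proof.
have key (c : R[i]) : slit_plane c -> 0 <= Im c ->
    exists L : R, forall l, L <= l -> 0 < Re c + l * Im c.
  move=> sc; rewrite le_eqVlt => /orP[/eqP c0|c0].
    exists 0 => l _; rewrite -c0 mulr0 addr0 ltNge; apply/negP => c1.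
    by apply: sc.
  exists ((1 - Re c) / Im c) => l; rewrite ler_pdivrMr//; lra.
have same (p q : R[i]) : slit_plane p -> slit_plane q -> 0 <= Im p -> 0 <= Im q ->
    exists l : R, 0 < Re p + l * Im p /\ 0 < Re q + l * Im q.
  move=> sp sq /(key _ sp)[L1 H1] /(key _ sq)[L2 H2]; exists (Num.max L1 L2).
  by split; [apply: H1|apply: H2]; rewrite le_max lexx ?orbT.
have conj_slit (c : R[i]) : slit_plane c -> slit_plane (conjc c).
  by move=> sc [c1 c2]; apply: sc; move: c1 c2; rewrite cRe_conj cIm_conj => ? ?; split=> //; lra.
case=> sa sb [ab|[ab ab']].
  have [a0|a0] := leP 0 (Im a).
    have [b0|b0] := leP 0 (Im b); first exact: same.
    have a00 : Im a = 0 by nra.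
    have [||l] := same _ _ (conj_slit _ sa) (conj_slit _ sb); rewrite ?cIm_conj; try lra.
    by rewrite !cRe_conj => -[h1 h2]; exists (- l); lra.
  have b0 : Im b <= 0 by nra.
  have [||l] := same _ _ (conj_slit _ sa) (conj_slit _ sb); rewrite ?cIm_conj; try lra.
  by rewrite !cRe_conj => -[h1 h2]; exists (- l); lra.
have a0 : Im a != 0 by apply/eqP => a0; rewrite a0 mul0r ltxx in ab.
have b0 : Im b != 0 by apply/eqP => b0; rewrite b0 mulr0 ltxx in ab.
(* the midpoint of the interval of separating slopes *)
exists (- (Re a / Im a + Re b / Im b) / 2).
set p := Re a / Im a; set q := Re b / Im b.
have -> : Re a = p * Im a by rewrite /p divfK.
have qE : Re b = q * Im b by rewrite /q divfK.
have : Im b * p < Im b * q.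
  rewrite [X in _ < X]mulrC -qE; apply: le_lt_trans ab'.
  by rewrite /p [X in _ <= X]mulrAC mulrA.
rewrite qE; have [b1|b1] := ltP 0 (Im b).
  have : Im a < 0 by nra.
  move=> ? ?; have : p < q by nra.
  by split; nra.
have : 0 < Im a by nra.
have b2 : Im b < 0 by lra.
move=> ? ?; have : q < p by nra.
by split; nra.
Qed.

(** On the hull, the separating form is at least its minimum over the three
    vertices, and it is bounded by 1 + |l| times the modulus. *)
Lemma hull_gap_gt0 a b : admissible a b -> 0 < hull_gap a b.
Proof.
move=> /admissible_halfplane[l [la lb]].
set k := Num.min 1 (Num.min (Re a + l * Im a) (Re b + l * Im b)).
have [k1 [ka kb]] : k <= 1 /\ k <= Re a + l * Im a /\ k <= Re b + l * Im b.
  by rewrite /k !ge_min !lexx ?orbT.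
have k0 : 0 < k by rewrite /k !lt_min ltr01 la lb.
have l0 : 0 < 1 + `|l| by rewrite ltr_wpDr.
apply: (@lt_le_trans _ _ (k / (1 + `|l|))); first by rewrite divr_gt0.
apply: lb_le_inf; first exact: (hull_gap_has_inf a b).1.
move=> _ [x [y [z [x0 y0 z0 s1 ->]]]]; rewrite ler_pdivrMr//.
set w := (X in cmod X).
apply: (@le_trans _ _ (Re w + l * Im w)).
  have -> : Re w + l * Im w =
      x + y * (Re a + l * Im a) + z * (Re b + l * Im b).
    by rewrite /w !cReImE/=; ring.
  have h1 := ler_wpM2l y0 ka; have h2 := ler_wpM2l z0 kb.
  have h3 := ler_wpM2l x0 k1.
  have -> : k = x * k + y * k + z * k by rewrite -!mulrDl s1 mul1r.
  lra.
rewrite mulrDr mulr1 lerD//.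
  by apply: le_trans (normRe_le _); exact: ler_norm.
apply: le_trans (ler_norm _) _; rewrite normrM mulrC.
by apply: ler_wpM2r => //; exact: normIm_le.
Qed.

(** Moving the vertices moves each point of the hull by at most the sum of the
    displacements, because the weights are at most 1. *)
Lemma hull_gap_lip a b a' b' :
  hull_gap a b <= hull_gap a' b' + (cmod (a - a') + cmod (b - b')).
Proof.
rewrite -lerBlDr; apply: lb_le_inf; first exact: (hull_gap_has_inf a' b').1.
move=> _ [x [y [z [x0 y0 z0 s1 ->]]]]; rewrite lerBlDr.
have := hull_gapP a b x0 y0 z0; rewrite s1 mulr1 => /le_trans; apply.
set w := (X in _ <= cmod X + _).
have -> : ((x%:C)%C + a * (y%:C)%C + b * (z%:C)%C)
    = w + ((a - a') * (y%:C)%C + (b - b') * (z%:C)%C).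
  by rewrite /w; ring.
apply: le_trans (cmodD_le _ _) _; rewrite lerD2l.
apply: le_trans (cmodD_le _ _) _; rewrite !cmodM !cmod_real !ger0_norm//.
by apply: lerD; rewrite ler_piMr ?cmod_ge0//; lra.
Qed.

Lemma hull_gap_continuous :
  continuous (fun p : R[i]^o * R[i]^o => hull_gap p.1 p.2).
Proof.
move=> p; apply/cvgrPdist_lt => e e0.
have e2 : 0 < ((e / 2)%:C)%C :> R[i] by rewrite ltcR divr_gt0.
have near1 : \forall q \near p, `|p.1 - q.1| < ((e / 2)%:C)%C.
  have cvgp : (fun q : R[i]^o * R[i]^o => q.1) q @[q --> p] --> p.1.
    by move=> A ?; exact: cvg_fst.
  exact: (@cvgr_dist_lt _ _ _ _ _ _ _ cvgp _ e2).
have near2 : \forall q \near p, `|p.2 - q.2| < ((e / 2)%:C)%C.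
  have cvgp : (fun q : R[i]^o * R[i]^o => q.2) q @[q --> p] --> p.2.
    by move=> A ?; exact: cvg_snd.
  exact: (@cvgr_dist_lt _ _ _ _ _ _ _ cvgp _ e2).
near=> q.
have h1 : cmod (p.1 - q.1) < e / 2 by rewrite -ltcR -cmod_norm; near: q.
have h2 : cmod (p.2 - q.2) < e / 2 by rewrite -ltcR -cmod_norm; near: q.
have := hull_gap_lip p.1 p.2 q.1 q.2.
have := hull_gap_lip q.1 q.2 p.1 p.2.
rewrite -[q.1 - p.1]opprB -[q.2 - p.2]opprB !cmodN => g1 g2.
by rewrite ltr_norml; apply/andP; split; lra.
Unshelve. all: by end_near. Qed.

Lemma gap_constant_continuous :
  {within [set p : R[i]^o * R[i]^o | admissible p.1 p.2],
    continuous (fun p : R[i]^o * R[i]^o => 4 / hull_gap p.1 p.2 ^+ 2)}.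
Proof.
apply: continuous_in_subspaceT => p; rewrite inE/= => /hull_gap_gt0 p0.
apply: cvgM; first exact: cvg_cst.
apply: cvgV; first by rewrite expf_neq0// gt_eqF.
by apply: cvgM; exact: hull_gap_continuous.
Qed.

End gap.

(** * Smooth cut-off functions *)

Section bump_profile.
Context {R : realType}.
Implicit Types (P : {poly R}) (t y : R).

(** The polynomial factor makes the family stable by derivation; the exponent is
    normalised so that [flat_exp 1] takes the value 1 at 1. *)
Definition flat_exp P t : R :=
  if 0 < t then P.[t^-1] * expR (1 - t^-1) else 0.

Lemma poly_le_expR P : exists C : R, 0 <= C /\
  forall y, 0 <= y -> `|P.[y]| <= C * expR y.
Proof.
elim/poly_ind: P => [|P c _].
  by exists 0; split=> // y _; rewrite horner0 normr0 mul0r.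
set p := P * 'X + c%:P.
exists (\sum_(i < size p) `|p`_i| * (i`!)%:R); split.
  by apply: sumr_ge0 => i _; rewrite mulr_ge0.
move=> y y0; rewrite horner_coef mulr_suml; apply: le_trans (ler_norm_sum _ _ _) _.
apply: ler_sum => i _; rewrite normrM -mulrA ler_wpM2l// ger0_norm ?exprn_ge0//.
case: (nat_of_ord i) => [|n].
  by rewrite expr0 fact0 mul1r -expR0 ler_expR.
rewrite mulrC -ler_pdivrMr ?ltr0n ?fact_gt0//.
by have := expR_ge1Dxn n y0; lra.
Qed.

(** The bound by C |t|, which makes the function differentiable at 0, is the
    plain bound for the polynomial X P, since P(1/t) / t = (X P)(1/t). *)
Lemma flat_exp_bound P : exists C : R, 0 <= C /\
  forall t, `|flat_exp P t| <= C /\ `|flat_exp P t| <= C * `|t|.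
Proof.
have bnd Q : exists C : R, 0 <= C /\ forall t, `|flat_exp Q t| <= C.
  have [C [C0 CQ]] := poly_le_expR Q; exists (C * expR 1).
  have C1 : 0 <= C * expR 1 by rewrite mulr_ge0// expR_ge0.
  split=> // t; rewrite /flat_exp; case: ifPn => [t0|_]; last by rewrite normr0.
  rewrite normrM (ger0_norm (expR_ge0 _)) expRD expRN.
  rewrite mulrCA [X in _ <= X]mulrC ler_wpM2l ?expR_ge0//.
  by rewrite ler_pdivrMr ?expR_gt0// CQ// invr_ge0 ltW.
have [C1 [C10 H1]] := bnd P; have [C2 [C20 H2]] := bnd ('X * P).
exists (C1 + C2); split; first exact: addr_ge0.
move=> t; split; first by apply: le_trans (H1 t) _; rewrite lerDl.
have := H2 t; rewrite /flat_exp; case: ifPn => [t0|_]; last first.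
  by rewrite normr0 => _; rewrite mulr_ge0// addr_ge0.
rewrite hornerM hornerX -mulrA normrM normfV mulrC ler_pdivrMr ?normr_gt0 ?gt_eqF//.
by move=> /le_trans; apply; rewrite ler_wpM2r// lerDr.
Qed.

Lemma is_derive_flat_exp P t :
  is_derive t 1 (flat_exp P) (flat_exp ('X^2 * (P - P^`())) t).
Proof.
have [t0|t0|t0] := ltgtP t 0.
- have -> : flat_exp ('X^2 * (P - P^`())) t = 0 by rewrite /flat_exp ltNge (ltW t0).
  apply: (@near_eq_is_derive _ _ _ (cst 0)).
  near=> s; rewrite /flat_exp ltNge (_ : s <= 0)//.
  by near: s; exact: lt_le_nbhsl.
- pose f s := P.[s^-1] * expR (1 - s^-1).
  apply: (@near_eq_is_derive _ _ _ f).
    near=> s; rewrite /flat_exp (_ : 0 < s)//.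
    by near: s; exact: lt_nbhsr.
  have tn : t != 0 by rewrite gt_eqF.
  have dV : is_derive t 1 (fun s : R => s^-1) (- t ^- 2).
    apply: is_derive_eq; first by apply: (@is_deriveV _ id).
    by rewrite [_%:A]mulr1.
  have d1 : is_derive t 1 (fun s : R => 1 - s^-1) (t ^- 2).
    by apply: is_derive_eq; rewrite add0r mul1r opprK.
  have d2 := is_derive1_comp (is_derive_poly P t^-1) dV.
  have d3 := @is_derive1_comp _ expR (fun s => 1 - s^-1) _ _ _ (is_derive_expR _) d1.
  have d4 := is_deriveM d2 d3.
  apply: (@is_derive_eq _ _ _ _ _ _ _ _ d4).
    rewrite /flat_exp t0 !hornerE/= /GRing.scale/= exprVn.
  ring.
- rewrite t0; have -> : flat_exp ('X^2 * (P - P^`())) 0 = 0 by rewrite /flat_exp ltxx.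
  have cvg0 : h^-1 *: ((flat_exp P \o shift 0) (h *: 1) - flat_exp P 0) @[h --> 0^'] --> (0:R).
    have [C [C0 HC]] := flat_exp_bound ('X * P).
    apply/cvgr0Pnorm_lt => e e0; near=> h.
    have h0 : h != 0 by near: h; exact: nbhs_dnbhs_neq.
    rewrite /= addr0 /GRing.scale/= mulr1 {2}/flat_exp ltxx subr0.
    have -> : h^-1 * flat_exp P h = flat_exp ('X * P) h.
      by rewrite /flat_exp; case: ifPn; rewrite ?mulr0// hornerM hornerX mulrA.
    apply: le_lt_trans (HC h).2 _.
    apply: (@le_lt_trans _ _ ((C + 1) * `|h|)); first by rewrite ler_wpM2r// lerDl.
    rewrite -ltr_pdivlMl ?ltr_wpDl//.
    near: h; apply: dnbhs0_lt; rewrite mulr_gt0// invr_gt0 ltr_wpDl//.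
  by apply: DeriveDef; [apply/cvg_ex; exists 0|apply: cvg_lim].
Unshelve. all: by end_near. Qed.

End bump_profile.

Section smooth_calculus.
Context {R : realType} {N : nat}.
Implicit Types (f g : 'rV[R]_N -> R) (x : 'rV[R]_N) (i : 'I_N).

Lemma deriveE_line f x (v : 'rV[R]_N) :
  'D_v f x = 'D_1 (fun h : R => f (h *: v + x)) 0.
Proof.
rewrite /derive; set g1 := fun h => h^-1 *: _; set g2 := fun h => h^-1 *: _.
suff -> : g1 = g2 by [].
by rewrite funeqE /g1 /g2 => h /=; rewrite addr0 scale0r add0r [_%:A]mulr1.
Qed.

(** Chain rule along a line: only the directional derivative of [f] is assumed to
    exist, [f] need not be differentiable. *)
Lemma is_derive_comp_line (k : R -> R) f x (v : 'rV[R]_N) (dk df : R) :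
  is_derive (f x) 1 k dk -> is_derive x v f df ->
  is_derive x v (k \o f) (dk * df).
Proof.
move=> Dk [f1 f2].
have Df : is_derive (0 : R) (1 : R) (fun h : R => f (h *: v + x)) df.
  by apply: DeriveDef; [exact: (derivable1P f x v).1|rewrite -deriveE_line].
have Dk0 : is_derive ((fun h : R => f (h *: v + x)) 0) (1 : R) k dk.
  by rewrite scale0r add0r.
have [d1 d2] := is_derive1_comp Dk0 Df.
by apply: DeriveDef; [exact: (derivable1P _ x v).2|rewrite deriveE_line].
Qed.

(** Smoothness by coinduction: it suffices to exhibit a class of continuous
    functions stable by partial derivation. *)
Lemma smooth_coind (S : set ('rV[R]_N -> R)) :
  (forall f, S f -> continuous f) ->
  (forall f i, S f -> exists2 g, S g & forall x, is_derive x 'e_i f (g x)) ->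
  forall f, S f -> smooth f.
Proof.
move=> Sc Sd f Sf s.
have Ss : S (iter_partial s f).
  elim: s => //= i s IH; have [g Sg dg] := Sd _ i IH.
  rewrite (_ : (fun x => _) = g)//; apply/funext => x.
  by have [_ ->] := dg x.
split; first exact: Sc.
by move=> i x; have [g _ dg] := Sd _ i Ss; have [] := dg x.
Qed.

Lemma smooth_continuous f : smooth f -> continuous f.
Proof. by move=> /(_ [::])[]. Qed.

Lemma smooth_derivable f i x : smooth f -> derivable f x 'e_i.
Proof. by move=> /(_ [::])[_]; apply. Qed.

Lemma smooth_partial f i : smooth f -> smooth ('D_('e_i) f).
Proof.
move=> sf s; have := sf (rcons s i).
by rewrite /iter_partial foldr_rcons.
Qed.

Lemma is_derive_coord x i j :
  is_derive x 'e_i (fun x : 'rV[R]_N => x 0 j) (('e_i : 'rV[R]_N) 0 j).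
Proof.
apply: DeriveDef; first by apply: diff_derivable; exact: differentiable_coord.
set c := ('e_i : 'rV[R]_N) 0 j; rewrite deriveE_line.
have -> : (fun h : R => (h *: 'e_i + x) 0 j) = (c \*: id + cst (x 0 j) : R -> R).
  by apply/funext => t; rewrite mxE [X in X + _]mxE mulrC.
have D : is_derive (0 : R) (1 : R) (c \*: id + cst (x 0 j) : R -> R) c.
  by apply: is_derive_eq; rewrite addr0 /GRing.scale/= mulr1.
by have [_ ->] := D.
Qed.

(** With [K] stable by derivation, this class is stable by partial derivation: the
    product and chain rules only use its own constructors. *)
Inductive smooth_gen (K : set (R -> R)) : ('rV[R]_N -> R) -> Prop :=
| gen_smooth f of smooth f : smooth_gen K f
| gen_cst (c : R) : smooth_gen K (fun=> c)
| gen_coord i : smooth_gen K (fun x => x 0 i)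
| gen_add f g of smooth_gen K f & smooth_gen K g : smooth_gen K (f + g)
| gen_mul f g of smooth_gen K f & smooth_gen K g : smooth_gen K (f * g)
| gen_comp k f of K k & smooth_gen K f : smooth_gen K (k \o f).

Lemma smooth_gen_smooth (K : set (R -> R)) f :
  (forall k, K k -> exists2 l, K l & forall t : R, is_derive t 1 k (l t)) ->
  smooth_gen K f -> smooth f.
Proof.
move=> HK; apply: smooth_coind => {f}.
  move=> f; elim=> {f}.
  - by move=> f; exact: smooth_continuous.
  - move=> c x; apply: cst_continuous.
  - by move=> i; exact: coord_continuous.
  - by move=> f g _ cf _ cg x; apply: continuousD; [exact: cf|exact: cg].
  - by move=> f g _ cf _ cg x; apply: continuousM; [exact: cf|exact: cg].
  - move=> k f Kk _ cf x; apply: continuous_comp; first exact: cf.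
    have [l _ dl] := HK _ Kk; apply: differentiable_continuous.
    by apply/derivable1_diffP; have [] := dl (f x).
move=> f i; elim=> {f}.
- move=> f sf; exists ('D_('e_i) f); first by apply: gen_smooth; exact: smooth_partial.
  by move=> x; apply: derivableP; exact: smooth_derivable.
- by move=> c; exists (fun=> 0) => [|x]; [exact: gen_cst|exact: is_derive_cst].
- move=> j; exists (fun=> ('e_i : 'rV[R]_N) 0 j) => [|x]; first exact: gen_cst.
  exact: is_derive_coord.
- move=> f g _ [f' Gf df] _ [g' Gg dg]; exists (f' + g') => [|x]; first exact: gen_add.
  by apply: is_deriveD.
- move=> f g Gf0 [f' Gf df] Gg0 [g' Gg dg]; exists (f * g' + g * f') => [|x].
    by apply: gen_add; apply: gen_mul.
  exact: is_deriveM.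
- move=> k f Kk Gf0 [f' Gf df]; have [l Kl dl] := HK _ Kk.
  exists ((l \o f) * f') => [|x]; first by apply: gen_mul => //; exact: gen_comp.
  exact: is_derive_comp_line.
Qed.

End smooth_calculus.

Section cutoff.
Context {R : realType} {N : nat}.
Implicit Types (s : R) (x : 'rV[R]_N) (i : 'I_N).

Lemma rV_norm_le x (r : R) : 0 <= r -> (`|x| <= r) <-> forall i, `|x 0 i| <= r.
Proof.
move=> r0; rewrite [`|x|]mx_normrE; split.
  move=> h i; apply: le_trans h.
  exact: (le_bigmax _ (fun ij : 'I_1 * 'I_N => `|x ij.1 ij.2|) (0, i)).
by move=> h; apply: bigmax_le => // -[j i] _ /=; rewrite (ord1 j).
Qed.

(* the same argument as in [cutoff], as a combination of functions *)
Let quad s : 'rV[R]_N -> R := cst 1 - (s ^+ 2 \*: \sum_(i < N) (fun x : 'rV[R]_N => x 0 i) ^+ 2).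

Let quadE s x : quad s x = 1 - s ^+ 2 * \sum_(i < N) x 0 i ^+ 2.
Proof. by rewrite /quad /= !fctE fct_sumE. Qed.

Definition cutoff s x : R := flat_exp 1 (1 - s ^+ 2 * \sum_(i < N) x 0 i ^+ 2).

Let cutoffE s : cutoff s = flat_exp 1 \o quad s.
Proof. by apply/funext => x; rewrite /= quadE. Qed.

Let is_derive_quad s x i : is_derive x 'e_i (quad s) (- (2 * s ^+ 2 * x 0 i)).
Proof.
have D j : is_derive x 'e_i ((fun x : 'rV[R]_N => x 0 j) ^+ 2)
   (2%:R * x 0 j ^+ 1 *: ('e_i : 'rV[R]_N) 0 j).
  by apply: (is_deriveX 2 (is_derive_coord x i j)).
apply: is_derive_eq.
rewrite sub0r /GRing.scale/= (bigD1 i)//= big1 ?addr0.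
  by rewrite mxE !eqxx/= mulr1 expr1; ring.
by move=> j ji; rewrite mxE eqxx (negbTE ji)/= mulr0.
Qed.

Lemma cutoff_smooth s : smooth (cutoff s).
Proof.
rewrite cutoffE; apply: (@smooth_gen_smooth _ _ [set k | exists P, k = flat_exp P]).
  move=> _ [P ->]; exists (flat_exp ('X^2 * (P - P^`()))); first by eexists.
  exact: is_derive_flat_exp.
apply: gen_comp; first by exists 1.
have -> : quad s = cst 1 + cst (- s ^+ 2) * \sum_(i < N) (fun x : 'rV[R]_N => x 0 i) ^+ 2.
  by apply/funext => x; rewrite quadE !fctE/= fct_sumE mulNr.
apply: gen_add; first exact: gen_cst.
apply: gen_mul; first exact: gen_cst.
elim/big_ind: _ => [|f g|i _]; first exact: gen_cst.
  exact: gen_add.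
by apply: gen_mul; exact: gen_coord.
Qed.

Lemma flat_exp1_itv (t : R) : t <= 1 -> 0 <= flat_exp 1 t <= 1.
Proof.
move=> t1; rewrite /flat_exp; case: ifPn => [t0|]; last by rewrite lexx ler01.
rewrite hornerC mul1r expR_ge0/= -[leRHS]expR0 ler_expR subr_le0.
by rewrite invf_ge1.
Qed.

Lemma cutoff_itv s x : 0 <= cutoff s x <= 1.
Proof.
apply: flat_exp1_itv; rewrite lerBlDr lerDl mulr_ge0 ?sqr_ge0//.
by apply: sumr_ge0 => i _; rewrite sqr_ge0.
Qed.

Lemma cutoff_arg_le0 s x : 0 < s -> s^-1 < `|x| ->
  1 - s ^+ 2 * \sum_(i < N) x 0 i ^+ 2 <= 0.
Proof.
move=> s0 sx; rewrite subr_le0.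
have [i xi] : exists i, s^-1 < `|x 0 i|.
  apply: contrapT => /forallNP h; move: sx; apply/negP; rewrite -leNgt.
  by apply/rV_norm_le => [|i]; [rewrite invr_ge0 ltW|rewrite leNgt; apply/negP/h].
rewrite (bigD1 i)//= mulrDr; apply: (@le_trans _ _ (s ^+ 2 * x 0 i ^+ 2)).
  rewrite -exprMn -[leLHS](expr1n _ 2) -[leRHS]real_normK ?num_real//.
  rewrite lerXn2r ?nnegrE//= normrM (gtr0_norm s0).
  by rewrite -ler_pdivrMl// mulr1 ltW.
rewrite lerDl mulr_ge0 ?sqr_ge0//.
by apply: sumr_ge0 => j _; rewrite sqr_ge0.
Qed.

Lemma cutoff_eq0 s x : 0 < s -> s^-1 < `|x| -> cutoff s x = 0.
Proof. by move=> s0 sx; rewrite /cutoff /flat_exp ltNge (cutoff_arg_le0 s0 sx). Qed.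

Lemma cutoff_partial s x i :
  'D_('e_i) (cutoff s) x =
  flat_exp 'X^2 (1 - s ^+ 2 * \sum_(j < N) x 0 j ^+ 2) * - (2 * s ^+ 2 * x 0 i).
Proof.
rewrite -quadE.
have := is_derive_comp_line (is_derive_flat_exp 1 (quad s x)) (is_derive_quad s x i).
rewrite -cutoffE => -[_ ->]; congr (flat_exp _ _ * _).
by rewrite derivC subr0 mulr1.
Qed.

Lemma cutoff_partial_eq0 s x i : 0 < s -> s^-1 < `|x| -> 'D_('e_i) (cutoff s) x = 0.
Proof.
move=> s0 sx; rewrite cutoff_partial /flat_exp.
by rewrite ltNge (cutoff_arg_le0 s0 sx)/= mul0r.
Qed.

Lemma cutoff_cvg x : cutoff n.+1%:R^-1 x @[n --> \oo] --> (1 : R).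
Proof.
have e1 : (1 : R) = cutoff 0 x.
  by rewrite /cutoff expr0n mul0r subr0 /flat_exp ltr01 hornerC invr1 subrr expR0 mulr1.
rewrite [X in _ --> X]e1.
have c1 : continuous (flat_exp 1 : R -> R).
  move=> t; apply: differentiable_continuous; apply/derivable1_diffP.
  by have [] := is_derive_flat_exp 1 t.
have h : 1 - n.+1%:R^-1 ^+ 2 * \sum_(i < N) x 0 i ^+ 2 @[n --> \oo] -->
    1 - (0 : R) ^+ 2 * \sum_(i < N) x 0 i ^+ 2.
  apply: cvgB; first exact: cvg_cst.
  apply: cvgM; last exact: cvg_cst.
  rewrite expr2 mul0r -[X in _ --> X](mul0r 0).
  by apply: cvgM; exact: cvg_harmonic.
exact: (cvg_comp _ _ h (c1 _)).
Qed.

End cutoff.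

(** The factor s^2 x_i from the inner derivative is at most s, because the
    derivative vanishes where |x| > 1/s. *)
Lemma cutoff_partial_bound {R : realType} : exists C : R, 0 <= C /\
  forall N (s : R) (x : 'rV[R]_N) i, 0 < s -> `|'D_('e_i) (cutoff s) x| <= C * s.
Proof.
have [C [C0 HC]] := @flat_exp_bound R 'X^2.
exists (2 * C); split=> [|N s x i s0]; first by rewrite mulr_ge0.
have [sx|sx] := ltP s^-1 `|x|.
  by rewrite cutoff_partial_eq0// normr0 !mulr_ge0// ltW.
have s2 : 0 <= 2 * s ^+ 2 by rewrite mulr_ge0// sqr_ge0.
rewrite cutoff_partial normrM normrN [X in _ * X]normrM (ger0_norm s2) -mulrA.
have si : 0 <= s^-1 by rewrite invr_ge0 ltW.
have xi : `|x 0 i| <= s^-1 by exact: ((rV_norm_le x si).1 sx i).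
have h2 : s ^+ 2 * `|x 0 i| <= s.
  rewrite expr2 -mulrA -[leRHS]mulr1 ler_wpM2l ?(ltW s0)//.
  by rewrite -ler_pdivlMl// mulr1.
rewrite [X in _ <= X](_ : _ = C * (2 * s)); last by ring.
apply: ler_pM => //; first by rewrite mulr_ge0.
  by case: (HC (1 - s ^+ 2 * \sum_(j < N) x 0 j ^+ 2)).
by rewrite -mulrA ler_wpM2l.
Qed.

(** * Borel sets of R^n *)

Section borel_rV.
Context {R : realType}.

Lemma measurable_box N (c : 'rV[R]_N) (r : R) :
  measurable [set x : 'rV[R]_N | forall i, `|x 0 i - c 0 i| < r].
Proof.
have -> : [set x : 'rV[R]_N | forall i, `|x 0 i - c 0 i| < r] =
    \bigcap_i (rV_coord i @^-1` `]c 0 i - r, c 0 i + r[%classic).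
  apply/seteqP; split => x /= H i.
    by move=> _; rewrite /rV_coord/= in_itv/=; have := H i; rewrite ltr_norml; lra.
  have := H i I; rewrite /rV_coord/= in_itv/= ltr_norml; lra.
apply: fin_bigcap_measurable => // i _.
by rewrite -[X in measurable X]setTI; apply: measurable_rV_coord => //; exact: measurable_itv.
Qed.

(** An open set is the union of the boxes with rational centre and radius 1/(k+1)
    that it contains. *)
Lemma open_measurable_rV N (U : set 'rV[R]_N) : open U -> measurable U.
Proof.
move=> oU.
pose box (qk : 'rV[rat]_N * nat) : set 'rV[R]_N :=
  [set x | forall i, `|x 0 i - (map_mx ratr qk.1) 0 i| < qk.2.+1%:R^-1].
have -> : U = \bigcup_(qk in [set: 'rV[rat]_N * nat])
    (if asbool (box qk `<=` U) then box qk else set0).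
  apply/seteqP; split=> x; last first.
    by move=> [qk _]; case: asboolP => // h /h.
  move=> Ux; have /nbhs_ballP[e /= e0 eU] := open_nbhs_nbhs (conj oU Ux).
  have [k] : exists k : nat, k.+1%:R^-1 < e / 2.
    have [k _ hk] := (near_infty_natSinv_lt (PosNum (divr_gt0 e0 (ltr0Sn _ 1)))).
    by exists k; apply: hk => /=.
  move=> ke.
  have ex i : exists q : rat, `|x 0 i - ratr q| < k.+1%:R^-1.
    have [|q] := @rat_in_itvoo R (x 0 i - k.+1%:R^-1) (x 0 i + k.+1%:R^-1).
      by rewrite ltrBlDr -addrA ltrDl addr_gt0.
    rewrite in_itv/= => /andP[h1 h2]; exists q.
    by rewrite distrC ltr_norml ltrBlDl h2 andbT ltrBrDl.
  have [q hq] := choice ex.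
  have xb : box (\row_i q i, k) x by move=> i; rewrite !mxE; exact: hq.
  exists (\row_i q i, k) => //; case: asboolP => // bU; exfalso; apply: bU.
  move=> y yb; apply: eU; rewrite -ball_normE/=.
  suff H : `|x - y| <= e / 2 + k.+1%:R^-1 by apply: le_lt_trans H _; rewrite [ltRHS]splitr ltrD2l.
  apply/rV_norm_le => [|i]; first by rewrite addr_ge0// divr_ge0// ltW.
  rewrite !mxE -(subrKA (ratr (q i))).
  apply: le_trans (ler_normD _ _) _; rewrite lerD//.
    by apply: ltW; apply: lt_trans ke; exact: hq.
  by apply: ltW; have := yb i; rewrite !mxE distrC.
apply: countable_bigcupT_measurable; first exact: countableP.
by move=> qk; case: ifP => // _; exact: measurable_box.
Qed.

Lemma continuous_measurable_rV N (f : 'rV[R]_N -> R) : continuous f ->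
  measurable_fun [set: 'rV[R]_N] f.
Proof.
move=> cf; apply: (measurability (@measurable_realfun.RGenOInfty.G R)).
  exact: measurable_realfun.RGenOInfty.measurableE.
move=> _ [_ [a ->] <-]; rewrite setTI; apply: open_measurable_rV.
by apply: open_comp => //; move=> ? _; exact: cf.
Qed.

Lemma measurable_cube N (r : R) :
  measurable [set x : 'rV[R]_N | (forall i, `|x 0 i| <= r)%R].
Proof.
have -> : [set x : 'rV[R]_N | (forall i, `|x 0 i| <= r)%R] =
    \bigcap_i (rV_coord i @^-1` `[- r, r]%classic).
  apply/seteqP; split => x /= H i.
    by move=> _; rewrite /rV_coord/= in_itv/=; have := H i; rewrite ler_norml.
  by have := H i I; rewrite /rV_coord/= in_itv/= ler_norml.
apply: fin_bigcap_measurable => // i _; rewrite -[X in measurable X]setTI.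
by apply: measurable_rV_coord => //; exact: measurable_itv.
Qed.

Lemma cube_finite_measure N (r : R) :
  (lebesgue_rV N [set x : 'rV[R]_N | (forall i, `|x 0 i| <= r)%R] < +oo)%E.
Proof.
elim: N => [|N IH].
  by rewrite /= diracE ltry.
set B := (X in (lebesgue_rV _ X < _)%E) in IH.
have mB : measurable B by exact: measurable_cube.
rewrite /= /lebesgue_rV_step /pushforward.
have -> : @rV_cons R N @^-1` [set x | forall i, `|x 0 i| <= r] = `[-r, r]%classic `*` B.
  apply/seteqP; split => -[t x] /=.
    move=> H; split=> [|i].
      by have := H ord0; rewrite /rV_cons mxE unlift_none/= in_itv/= ler_norml.
    by have := H (lift ord0 i); rewrite /rV_cons mxE liftK.
  move=> [tr Bx] i; rewrite /rV_cons mxE; case: unliftP => [j|] _ /=.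
    exact: Bx.
  by move: tr; rewrite in_itv/= ler_norml.
rewrite product_measure1E//=.
have Ifin : (lebesgue_measure `[(- r)%R, r] < +oo :> \bar R)%E.
  by rewrite lebesgue_measure_itv/=; case: ifP => // _; rewrite -EFinB ltry.
by rewrite lte_mul_pinfty// ge0_fin_numE.
Qed.

End borel_rV.

(** * Integration of complex-valued functions *)

Section complex_integral.
Context {R : realType} {N : nat} (Omega : set 'rV[R]_N).
Hypothesis mOmega : measurable Omega.
Local Notation Re := (@complex.Re R).
Local Notation Im := (@complex.Im R).
Local Notation mu := (lebesgue_rV N : measure _ R).
Implicit Types (f g : 'rV[R]_N -> R[i]) (h k : 'rV[R]_N -> R).

Definition rintegrable h := (mu.-integrable Omega (EFin \o h))%E.

Definition cmeasurable f :=
  measurable_fun Omega (fun x => Re (f x)) /\ measurable_fun Omega (fun x => Im (f x)).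

Definition cintegrable f :=
  rintegrable (fun x => Re (f x)) /\ rintegrable (fun x => Im (f x)).

Lemma rintegrable_measurable h : rintegrable h -> measurable_fun Omega h.
Proof. by move=> /integrableP[/measurable_EFinP]. Qed.

Lemma rintegrable_le h k : measurable_fun Omega h -> rintegrable k ->
  (forall x, Omega x -> `|h x| <= k x) -> rintegrable h.
Proof.
move=> mh ik hk; apply: (le_integrable mOmega _ _ ik); first exact/measurable_EFinP.
move=> x Ox; rewrite /= lee_fin; apply: le_trans (hk _ Ox) _; exact: ler_norm.
Qed.

Lemma rintegrableD h k : rintegrable h -> rintegrable k ->
  rintegrable (fun x => h x + k x).
Proof. exact: (@integrableD _ _ _ _ _ mOmega). Qed.

Lemma rintegrableZ (c : R) h : rintegrable h -> rintegrable (fun x => c * h x).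
Proof. exact: (@integrableZl _ _ _ _ _ mOmega). Qed.

Lemma rintegrable_eq h k : {in Omega, h =1 k} -> rintegrable h -> rintegrable k.
Proof.
by move=> hk; apply: eq_integrable => // x Ox; rewrite /= hk.
Qed.

Lemma cmeasurableD f g : cmeasurable f -> cmeasurable g ->
  cmeasurable (fun x => f x + g x).
Proof.
move=> [f1 f2] [g1 g2]; split.
  by under eq_fun do rewrite cReD; exact: measurable_funD.
by under eq_fun do rewrite cImD; exact: measurable_funD.
Qed.

Lemma cmeasurableM f g : cmeasurable f -> cmeasurable g ->
  cmeasurable (fun x => f x * g x).
Proof.
move=> [f1 f2] [g1 g2]; split.
  by under eq_fun do rewrite cReM; apply: measurable_funB; apply: measurable_funM.
by under eq_fun do rewrite cImM; apply: measurable_funD; apply: measurable_funM.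
Qed.

Lemma cmeasurable_cst (c : R[i]) : cmeasurable (fun=> c).
Proof. by split; exact: measurable_cst. Qed.

Lemma cmeasurable_real h : measurable_fun Omega h -> cmeasurable (fun x => (h x)%:C%C).
Proof. by move=> mh; split => //=; exact: measurable_cst. Qed.

Lemma cmeasurable_conj f : cmeasurable f -> cmeasurable (fun x => conjc (f x)).
Proof.
move=> [f1 f2]; split; first by under eq_fun do rewrite cRe_conj.
by under eq_fun do rewrite cIm_conj; exact: measurable_funN.
Qed.

Lemma cmeasurableN f : cmeasurable f -> cmeasurable (fun x => - f x).
Proof.
move=> [f1 f2]; split.
  by under eq_fun do rewrite cReN; exact: measurable_funN.
by under eq_fun do rewrite cImN; exact: measurable_funN.
Qed.

Lemma cmeasurableB f g : cmeasurable f -> cmeasurable g ->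
  cmeasurable (fun x => f x - g x).
Proof. by move=> mf mg; apply: cmeasurableD => //; exact: cmeasurableN. Qed.

Lemma measurable_cmod f : cmeasurable f -> measurable_fun Omega (fun x => cmod (f x)).
Proof.
move=> [f1 f2]; under eq_fun do rewrite cmodE.
have ms : measurable_fun [set: R] (@Num.sqrt R).
  exact: (continuous_measurable_fun (@sqrt_continuous R)).
apply: (measurableT_comp ms).
by apply: measurable_funD; exact: measurable_funX.
Qed.

Lemma cintegrable_measurable f : cintegrable f -> cmeasurable f.
Proof. by case=> /rintegrable_measurable ? /rintegrable_measurable. Qed.

Lemma cintegrable_le f h : cmeasurable f -> rintegrable h ->
  (forall x, Omega x -> cmod (f x) <= h x) -> cintegrable f.
Proof.
move=> [f1 f2] ih fh; split; apply: rintegrable_le ih _ => // x Ox.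
  by apply: le_trans (fh _ Ox); exact: normRe_le.
by apply: le_trans (fh _ Ox); exact: normIm_le.
Qed.

Lemma cintegrable_eq f g : {in Omega, f =1 g} -> cintegrable f -> cintegrable g.
Proof.
by move=> fg [f1 f2]; split; [move: f1|move: f2]; apply: rintegrable_eq => x Ox; rewrite fg.
Qed.

Lemma rintegrable_cmod f : cintegrable f -> rintegrable (fun x => cmod (f x)).
Proof.
move=> fi; have [f1 f2] := fi.
apply: (@rintegrable_le _ (fun x => `|Re (f x)| + `|Im (f x)|)).
- by apply: measurable_cmod; exact: cintegrable_measurable.
- by apply: rintegrableD; exact: integrable_norm.
- by move=> x _; rewrite ger0_norm ?cmod_ge0// cmod_le.
Qed.

Lemma cintegrableD f g : cintegrable f -> cintegrable g ->
  cintegrable (fun x => f x + g x).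
Proof.
move=> [f1 f2] [g1 g2]; split.
  by under eq_fun do rewrite cReD; exact: rintegrableD.
by under eq_fun do rewrite cImD; exact: rintegrableD.
Qed.

Lemma cintegrableZ (c : R[i]) f : cintegrable f -> cintegrable (fun x => c * f x).
Proof.
move=> fi; apply: (@cintegrable_le _ (fun x => cmod c * cmod (f x))).
- by apply: cmeasurableM; [exact: cmeasurable_cst|exact: cintegrable_measurable].
- by apply: rintegrableZ; exact: rintegrable_cmod.
- by move=> x _; rewrite cmodM.
Qed.

Lemma cintegrableN f : cintegrable f -> cintegrable (fun x => - f x).
Proof.
move=> /(cintegrableZ (-1)); apply: cintegrable_eq => x _.
by rewrite mulN1r.
Qed.

Lemma cintegrableB f g : cintegrable f -> cintegrable g ->
  cintegrable (fun x => f x - g x).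
Proof. by move=> fi gi; apply: cintegrableD => //; exact: cintegrableN. Qed.

Lemma cintegrable_sum n (f : 'I_n -> 'rV[R]_N -> R[i]) :
  (forall i, cintegrable (f i)) -> cintegrable (fun x => \sum_(i < n) f i x).
Proof.
elim: n f => [|n IH] f fi.
  have -> : (fun x => \sum_(i < 0) f i x) = (fun=> 0) by apply/funext => x; rewrite big_ord0.
  by split; exact: integrable0.
under [X in cintegrable X]eq_fun do rewrite big_ord_recr/=.
by apply: cintegrableD => //; apply: IH => i.
Qed.

Lemma eq_cintegral f g : {in Omega, f =1 g} ->
  cintegral Omega f = cintegral Omega g.
Proof.
by move=> fg; rewrite /cintegral; congr Complex; apply: eq_Rintegral => x Ox; rewrite fg.
Qed.

Lemma cintegralD f g : cintegrable f -> cintegrable g ->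
  cintegral Omega (fun x => f x + g x) = cintegral Omega f + cintegral Omega g.
Proof.
move=> [f1 f2] [g1 g2]; apply: eqc; rewrite ?(cReD,cImD)/=.
  by under eq_Rintegral do rewrite cReD; rewrite RintegralD.
by under eq_Rintegral do rewrite cImD; rewrite RintegralD.
Qed.

Lemma cintegralZ (c : R[i]) f : cintegrable f ->
  cintegral Omega (fun x => c * f x) = c * cintegral Omega f.
Proof.
move=> [f1 f2]; apply: eqc; rewrite ?(cReM,cImM)/=.
  under eq_Rintegral do rewrite cReM.
  by rewrite RintegralB ?RintegralZl//; exact: rintegrableZ.
under eq_Rintegral do rewrite cImM.
by rewrite RintegralD ?RintegralZl//; exact: rintegrableZ.
Qed.

Lemma cintegralN f : cintegrable f ->
  cintegral Omega (fun x => - f x) = - cintegral Omega f.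
Proof.
move=> fi; rewrite -mulN1r -cintegralZ//; apply: eq_cintegral => x _.
by rewrite mulN1r.
Qed.

Lemma cintegralB f g : cintegrable f -> cintegrable g ->
  cintegral Omega (fun x => f x - g x) = cintegral Omega f - cintegral Omega g.
Proof. by move=> fi gi; rewrite cintegralD ?cintegralN//; exact: cintegrableN. Qed.

Lemma cintegral_sum n (f : 'I_n -> 'rV[R]_N -> R[i]) :
  (forall i, cintegrable (f i)) ->
  cintegral Omega (fun x => \sum_(i < n) f i x) = \sum_(i < n) cintegral Omega (f i).
Proof.
elim: n f => [|n IH] f fi.
  rewrite big_ord0 (@eq_cintegral _ (fun=> 0)); last by move=> x _; rewrite big_ord0.
  by apply: eqc; rewrite /= Rintegral_cst// mul0r.
rewrite (@eq_cintegral _ (fun x => \sum_(i < n) f (widen_ord (leqnSn n) i) x + f ord_max x)).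
  rewrite cintegralD ?IH ?big_ord_recr//=.
  by apply: cintegrable_sum => i.
by move=> x _; rewrite big_ord_recr.
Qed.

Lemma ae_eq_cintegral f g : cmeasurable f -> cmeasurable g ->
  {ae mu, forall x, Omega x -> f x = g x} ->
  cintegral Omega f = cintegral Omega g.
Proof.
move=> [f1 f2] [g1 g2] fg; apply: eqc; rewrite /= /Rintegral; congr fine.
  apply: ae_eq_integral => //; try exact/measurable_EFinP.
  by apply: filterS fg => x + Ox => /(_ Ox) ->.
apply: ae_eq_integral => //; try exact/measurable_EFinP.
by apply: filterS fg => x + Ox => /(_ Ox) ->.
Qed.

Lemma cmod_cintegral_le f h : cintegrable f -> rintegrable h ->
  (forall x, Omega x -> cmod (f x) <= h x) ->
  cmod (cintegral Omega f) <= 2 * \int[mu]_(x in Omega) h x.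
Proof.
move=> [f1 f2] ih fh; apply: le_trans (cmod_le _) _ => /=.
have key (k : 'rV[R]_N -> R) : rintegrable k -> (forall x, Omega x -> `|k x| <= h x) ->
    `|\int[mu]_(x in Omega) k x| <= \int[mu]_(x in Omega) h x.
  move=> ik kh; apply: le_trans (le_normr_Rintegral mOmega ik) _.
  by apply: le_Rintegral => //; exact: integrable_norm.
rewrite mulr_natl mulr2n lerD//; apply: key => // x Ox.
  by apply: le_trans (fh _ Ox); exact: normRe_le.
by apply: le_trans (fh _ Ox); exact: normIm_le.
Qed.

End complex_integral.

(** * Square-integrable functions *)

Section square_integrable.
Context {R : realType} {N : nat} (Omega : set 'rV[R]_N).
Hypothesis mOmega : measurable Omega.
Local Notation mu := (lebesgue_rV N : measure _ R).
Implicit Types (f g : 'rV[R]_N -> R[i]) (h k : 'rV[R]_N -> R).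

Definition sqint f :=
  cmeasurable Omega f /\ rintegrable Omega (fun x => cmod (f x) ^+ 2).

Definition energy f : R := \int[mu]_(x in Omega) (cmod (f x) ^+ 2).

Lemma energy_ge0 f : 0 <= energy f.
Proof. by apply: Rintegral_ge0 => x _; rewrite sqr_ge0. Qed.

Lemma cLnorm_pow (p : R) f : 0 < p ->
  (cLnorm Omega p f `^ p = \int[mu]_(x in Omega) (cmod (f x) `^ p)%:E)%E.
Proof.
move=> p0; rewrite /cLnorm powR_Lnorm ?gt_eqF// [RHS]integral_mkcond.
apply: eq_integral => x _; rewrite /patch; case: ifPn => _.
  by rewrite /= ger0_norm ?cmod_ge0.
by rewrite abse0 poweR0r// gt_eqF.
Qed.

Lemma poweR2 (x : \bar R) : (0 <= x)%E -> (x `^ 2 = x ^+ 2)%E.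
Proof.
case: x => [r| |]//= r0; last by rewrite pnatr_eq0.
by rewrite powR_mulrn// EFin_expe.
Qed.

Lemma cLnorm2_sqr f : (cLnorm Omega 2 f ^+ 2 = \int[mu]_(x in Omega) (cmod (f x) ^+ 2)%:E)%E.
Proof.
rewrite -poweR2 ?Lnorm_ge0// cLnorm_pow//; apply: eq_integral => x _.
by rewrite powR_mulrn// cmod_ge0.
Qed.

Lemma cLpP (p : R) f : 0 < p -> cLp Omega p f <->
  cmeasurable Omega f /\ rintegrable Omega (fun x => cmod (f x) `^ p).
Proof.
move=> p0.
have mp : cmeasurable Omega f -> measurable_fun Omega (fun x => cmod (f x) `^ p).
  move=> mf; apply: (measurableT_comp (measurable_powR p)); exact: measurable_cmod.
have absE : (\int[mu]_(x in Omega) `|(cmod (f x) `^ p)%:E| =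
    \int[mu]_(x in Omega) (cmod (f x) `^ p)%:E)%E.
  by apply: eq_integral => x _; rewrite /= ger0_norm// powR_ge0.
split=> [[m1 m2 foo]|[[m1 m2] /integrableP[_ foo]]].
  split=> //; apply/integrableP; split; first by apply/measurable_EFinP; exact: mp.
  by rewrite /comp absE -cLnorm_pow// poweR_lty.
split=> //; apply: (@lty_poweRy _ _ p); first by rewrite gt_eqF.
by rewrite cLnorm_pow// -absE.
Qed.

Lemma cLp2P f : cLp Omega 2 f <-> sqint f.
Proof.
have fE : (fun x => cmod (f x) `^ 2) = (fun x => cmod (f x) ^+ 2).
  by apply/funext => x; rewrite powR_mulrn// cmod_ge0.
by rewrite cLpP// fE.
Qed.

Lemma rintegral_fin h : rintegrable Omega h ->
  (\int[mu]_(x in Omega) (h x)%:E)%E = (\int[mu]_(x in Omega) h x)%:E.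
Proof. by move=> ih; rewrite /Rintegral fineK// integrable_fin_num. Qed.

Lemma cLnorm2_energy f : sqint f -> (cLnorm Omega 2 f ^+ 2 = (energy f)%:E)%E.
Proof. by case=> _ fi; rewrite cLnorm2_sqr rintegral_fin. Qed.

Lemma sqintD f g : sqint f -> sqint g -> sqint (fun x => f x + g x).
Proof.
move=> [mf fi] [mg gi]; have mfg := cmeasurableD mf mg; split=> //.
apply: (@rintegrable_le _ _ _ mOmega _ (fun x => 2 * cmod (f x) ^+ 2 + 2 * cmod (g x) ^+ 2)).
- by apply: measurable_funX; exact: measurable_cmod.
- by apply: rintegrableD => //; exact: rintegrableZ.
- move=> x _; rewrite ger0_norm ?sqr_ge0//.
  apply: (@le_trans _ _ ((cmod (f x) + cmod (g x)) ^+ 2)).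
    by rewrite lerXn2r ?nnegrE ?addr_ge0 ?cmod_ge0// cmodD_le.
  have := sqr_ge0 (cmod (f x) - cmod (g x)); nra.
Qed.

Lemma sqintM_bdd (C : R) f g : sqint f -> cmeasurable Omega g ->
  (forall x, Omega x -> cmod (g x) <= C) -> sqint (fun x => g x * f x).
Proof.
move=> [mf fi] mg gC; have mfg := cmeasurableM mg mf; split=> //.
apply: (@rintegrable_le _ _ _ mOmega _ (fun x => C ^+ 2 * cmod (f x) ^+ 2)).
- by apply: measurable_funX; exact: measurable_cmod.
- exact: rintegrableZ.
- move=> x Ox; rewrite ger0_norm ?sqr_ge0// cmodM exprMn ler_wpM2r ?sqr_ge0//.
  have g0 := cmod_ge0 (g x); have gx := gC _ Ox.
  by rewrite lerXn2r ?nnegrE//; exact: le_trans gx.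
Qed.

Lemma sqintZ (c : R[i]) f : sqint f -> sqint (fun x => c * f x).
Proof.
move=> sf; apply: (@sqintM_bdd (cmod c)) => //; exact: cmeasurable_cst.
Qed.

Lemma sqint_conj f : sqint f -> sqint (fun x => conjc (f x)).
Proof.
move=> [mf fi]; split; first exact: cmeasurable_conj.
by under eq_fun do rewrite cmod_conj.
Qed.

Lemma sqint_eq f g : f =1 g -> sqint f -> sqint g.
Proof. by move=> /funext ->. Qed.

Lemma sqintB f g : sqint f -> sqint g -> sqint (fun x => f x - g x).
Proof.
move=> sf sg; apply: sqintD => //; apply: sqint_eq (sqintZ (-1) sg) => x.
by rewrite mulN1r.
Qed.

Lemma energy_conj f : energy (fun x => conjc (f x)) = energy f.
Proof. by rewrite /energy; under eq_Rintegral do rewrite cmod_conj. Qed.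

Lemma cintegrable_sqM f g : sqint f -> sqint g -> cintegrable Omega (fun x => f x * g x).
Proof.
move=> [mf fi] [mg gi].
apply: (@cintegrable_le _ _ _ mOmega _ (fun x => cmod (f x) ^+ 2 + cmod (g x) ^+ 2)).
- exact: cmeasurableM.
- exact: rintegrableD.
- move=> x _; rewrite cmodM.
  have := sqr_ge0 (cmod (f x) - cmod (g x)); have := cmod_ge0 (f x); have := cmod_ge0 (g x); nra.
Qed.

(** Young's inequality with a free weight; it replaces the Cauchy-Schwarz
    inequality both for smallness estimates and for the final absorption. The
    factor 1/2 is lost by bounding the real and imaginary parts separately. *)
Lemma cintegral_young (e : R) f g : 0 < e -> sqint f -> sqint g ->
  cmod (cintegral Omega (fun x => f x * g x)) <= e * energy f + e^-1 * energy g.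
Proof.
move=> e0 sf sg; have [mf fi] := sf; have [mg gi] := sg.
have ifg := cintegrable_sqM sf sg.
pose h x := (e / 2) * cmod (f x) ^+ 2 + (e^-1 / 2) * cmod (g x) ^+ 2.
have ih : rintegrable Omega h by apply: rintegrableD => //; exact: rintegrableZ.
apply: (@le_trans _ _ (2 * \int[mu]_(x in Omega) h x)).
  apply: cmod_cintegral_le => // x _; rewrite cmodM /h.
  set p := cmod (f x); set q := cmod (g x).
  have -> : e / 2 * p ^+ 2 + e^-1 / 2 * q ^+ 2 = p * q + e^-1 / 2 * (e * p - q) ^+ 2.
    by field; rewrite gt_eqF.
  by rewrite lerDl mulr_ge0 ?sqr_ge0// divr_ge0// invr_ge0 ltW.
rewrite /h RintegralD//; [|exact: rintegrableZ..].
by rewrite !RintegralZl// -/(energy f) -/(energy g); lra.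
Qed.

(** A cube has finite measure. *)
Lemma sqint_bdd_cube (C r : R) f : cmeasurable Omega f ->
  (forall x, cmod (f x) <= C) -> (forall x, r < `|x| -> f x = 0) -> sqint f.
Proof.
move=> mf fC fr; split=> //.
pose K := Omega `&` [set x : 'rV[R]_N | (forall i, `|x 0 i| <= r)%R].
have mcube := @measurable_cube R N r.
have mK : measurable K by exact: measurableI.
have Kfin : (mu K < +oo)%E.
  apply: le_lt_trans (cube_finite_measure N r); apply: le_measure; rewrite ?inE//.
  by move=> x [].
have iK : rintegrable K (fun x => cmod (f x) ^+ 2).
  apply: measurable_bounded_integrable => //.
    apply: measurable_funX; apply: measurable_funS (measurable_cmod mf) => //.
    by move=> x [].
  exists (C ^+ 2); split; first by rewrite num_real.
  move=> M CM x _ /=; rewrite ger0_norm ?sqr_ge0//; apply: le_trans (ltW CM).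
  by rewrite lerXn2r ?nnegrE ?cmod_ge0//; apply: le_trans (fC x); exact: cmod_ge0.
have := (integrable_mkcond _ mK).1 iK => iT.
apply/(integrable_mkcond _ mOmega); move: iT; apply: eq_integrable => // x _.
rewrite /patch; case: ifPn; case: ifPn => //; rewrite ?inE.
- by move=> nO []; rewrite notin_setE in nO.
- move=> Ox; rewrite notin_setE => nK; have [rx|rx] := ltP r `|x|.
    by rewrite /= fr// cmodE/= expr0n/= addr0 sqrtr0 expr0n.
  have r0 : 0 <= r by apply: le_trans rx.
  by exfalso; apply: nK; split=> //; apply/rV_norm_le.
Qed.

End square_integrable.

(** * Test functions *)

Section test_functions.
Context {R : realType} {N : nat} (Omega : set 'rV[R]_N).
Hypothesis mOmega : measurable Omega.
Local Notation Re := (@complex.Re R).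
Local Notation Im := (@complex.Im R).
Implicit Types (phi psi : 'rV[R]_N -> R[i]) (chi : 'rV[R]_N -> R).

(** Only the support and the smoothness matter, hence all the stability
    properties of test functions below. *)
Lemma test_fun_sub phi psi : test_fun Omega phi ->
  smooth (fun x => Re (psi x)) -> smooth (fun x => Im (psi x)) ->
  [set x | psi x != 0] `<=` closure [set x | phi x != 0] ->
  test_fun Omega psi.
Proof.
move=> [_ _ cphi sphi] s1 s2 sub.
have cl : closure [set x | psi x != 0] `<=` closure [set x | phi x != 0].
  rewrite [X in _ `<=` X]((closure_id _).1 (@closed_closure _ _)).
  exact: closureS.
split=> //; first by apply: subclosed_compact cphi cl; exact: closed_closure.
exact: subset_trans cl sphi.
Qed.

Lemma smooth_cst (c : R) : smooth (fun _ : 'rV[R]_N => c).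
Proof. by apply: (@smooth_gen_smooth _ _ set0) => //; exact: gen_cst. Qed.

Lemma smoothM (f g : 'rV[R]_N -> R) : smooth f -> smooth g -> smooth (fun x => f x * g x).
Proof.
by move=> sf sg; apply: (@smooth_gen_smooth _ _ set0) => //; apply: gen_mul; exact: gen_smooth.
Qed.

Lemma smoothN (f : 'rV[R]_N -> R) : smooth f -> smooth (fun x => - f x).
Proof.
move=> sf; have := smoothM (smooth_cst (-1)) sf.
by under eq_fun do rewrite mulN1r.
Qed.

Lemma test_fun_conj phi : test_fun Omega phi -> test_fun Omega (fun x => conjc (phi x)).
Proof.
move=> tphi; have [s1 s2 _ _] := tphi; apply: (test_fun_sub tphi).
- by under eq_fun do rewrite cRe_conj.
- by under eq_fun do rewrite cIm_conj; exact: smoothN.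
- move=> x /= h; apply: subset_closure => /=; apply: contra_neq h => ->.
  by rewrite rmorph0.
Qed.

Lemma Re_realM (c : R) (z : R[i]) : Re ((c%:C)%C * z) = c * Re z.
Proof. by rewrite cReM/= mul0r subr0. Qed.

Lemma Im_realM (c : R) (z : R[i]) : Im ((c%:C)%C * z) = c * Im z.
Proof. by rewrite cImM/= mul0r addr0. Qed.

Lemma test_funM chi phi : smooth chi -> test_fun Omega phi ->
  test_fun Omega (fun x => (chi x)%:C%C * phi x).
Proof.
move=> sc tphi; have [s1 s2 _ _] := tphi; apply: (test_fun_sub tphi).
- by under eq_fun do rewrite Re_realM; exact: smoothM.
- by under eq_fun do rewrite Im_realM; exact: smoothM.
- move=> x /= h; apply: subset_closure => /=; apply: contra_neq h => ->.
  by rewrite mulr0.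
Qed.

Lemma test_fun_partial i phi : test_fun Omega phi -> test_fun Omega (cpartial i phi).
Proof.
move=> tphi; have [s1 s2 _ _] := tphi; apply: (test_fun_sub tphi).
- exact: smooth_partial.
- exact: smooth_partial.
- move=> x /=; apply: contra_neqP => nx.
  have nearx : \forall y \near x, phi y = 0.
    have oC : open (~` closure [set x | phi x != 0]) by rewrite openC; exact: closed_closure.
    have := open_nbhs_nbhs (conj oC nx); apply: filterS => y ny.
    by apply: contrapT => /eqP ne; apply: ny; exact: subset_closure.
  have d0 (p : R[i] -> R) : p 0 = 0 -> 'D_('e_i) (fun y => p (phi y)) x = 0.
    move=> p0; rewrite (@near_eq_derive _ _ _ _ (cst 0)) ?derive_cst//.
    by apply: filterS nearx => y ->.
  by apply: eqc => /=; exact: d0.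
Qed.

Lemma cpartial_realM chi phi i x : smooth chi ->
  smooth (fun x => Re (phi x)) -> smooth (fun x => Im (phi x)) ->
  cpartial i (fun x => (chi x)%:C%C * phi x) x =
  (chi x)%:C%C * cpartial i phi x + ('D_('e_i) chi x)%:C%C * phi x.
Proof.
move=> sc s1 s2.
have key (f : 'rV[R]_N -> R) : smooth f ->
    'D_('e_i) (fun y => chi y * f y) x = chi x * 'D_('e_i) f x + 'D_('e_i) chi x * f x.
  move=> sf; rewrite deriveM; [|exact: smooth_derivable..].
  by rewrite /GRing.scale/= [f x * _]mulrC.
apply: eqc; rewrite ?(cReD,cImD) ?Re_realM ?Im_realM/= /cpartial/=.
  by under eq_fun do rewrite Re_realM; exact: key.
by under eq_fun do rewrite Im_realM; exact: key.
Qed.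

Lemma cpartial_conj phi i x :
  smooth (fun x => Im (phi x)) ->
  cpartial i (fun x => conjc (phi x)) x = conjc (cpartial i phi x).
Proof.
move=> s2; apply: eqc; rewrite ?(cRe_conj,cIm_conj) /cpartial/=.
  by under eq_fun do rewrite cRe_conj.
under eq_fun do rewrite cIm_conj.
by rewrite -deriveN//; exact: smooth_derivable.
Qed.

Lemma smooth_cmeasurable phi : smooth (fun x => Re (phi x)) ->
  smooth (fun x => Im (phi x)) -> cmeasurable Omega phi.
Proof.
by move=> s1 s2; split; apply: measurable_funTS; apply: continuous_measurable_rV;
  exact: smooth_continuous.
Qed.

Lemma test_fun_bounded phi : test_fun Omega phi -> exists C r : R,
  (forall x, cmod (phi x) <= C) /\ (forall x, r < `|x| -> phi x = 0).
Proof.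
move=> [s1 s2 cK _]; set K := closure _ in cK.
have off x : ~ K x -> phi x = 0.
  by move=> nK; apply: contrapT => /eqP h; apply: nK; exact: subset_closure.
have bnd (f : 'rV[R]_N -> R) : smooth f -> exists C : R, forall x, K x -> `|f x| <= C.
  move=> sf; have cfK : compact (f @` K).
    apply: continuous_compact => //; apply: continuous_subspaceT.
    exact: smooth_continuous.
  have [M [_ HM]] := compact_bounded cfK.
  exists (M + 1) => x Kx; apply: HM; first by rewrite ltrDl.
  by exists x.
have [C1 H1] := bnd _ s1; have [C2 H2] := bnd _ s2.
have [r [_ Hr]] := compact_bounded cK.
exists (`|C1| + `|C2|), (r + 1); split=> x.
  have [Kx|/off ->] := pselect (K x).
    apply: le_trans (cmod_le _) _; apply: lerD.
      by apply: le_trans (H1 _ Kx) _; exact: ler_norm.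
    by apply: le_trans (H2 _ Kx) _; exact: ler_norm.
  by rewrite cmodE/= expr0n/= addr0 sqrtr0 addr_ge0.
move=> rx; apply: off => Kx; have := Hr (r + 1) _ x Kx.
by rewrite ltrDl ltr01 => /(_ isT) /=; rewrite leNgt rx.
Qed.

Lemma test_fun_sqint phi : test_fun Omega phi -> sqint Omega phi.
Proof.
move=> tphi; have [s1 s2 _ _] := tphi.
have [C [r [HC Hr]]] := test_fun_bounded tphi.
by apply: (sqint_bdd_cube mOmega _ HC Hr); exact: smooth_cmeasurable.
Qed.

End test_functions.

(** * The power nonlinearity *)

Section nonlinearity.
Context {R : realType}.
Implicit Types (m : R) (a b z : R[i]).

Definition cpow m z : R[i] := ((cmod z `^ (- (1 - m)))%:C)%C * z.

Lemma nonlinE m a b z : nonlin m a b z = a * cpow m z + b * z.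
Proof. by rewrite /nonlin /cpow mulrA. Qed.

Lemma cmod0 : cmod (0 : R[i]) = 0.
Proof. by rewrite cmodE/= expr0n/= addr0 sqrtr0. Qed.

Lemma cmod_eq0 z : cmod z = 0 -> z = 0.
Proof. exact: ComplexField.Normc.eq0_normc. Qed.

Lemma cmod_cpow m z : z != 0 -> cmod (cpow m z) = cmod z `^ m.
Proof.
move=> z0; have zp : 0 < cmod z.
  by rewrite lt_def cmod_ge0 andbT; apply: contra_neq z0; exact: cmod_eq0.
rewrite /cpow cmodM cmod_real ger0_norm ?powR_ge0//.
rewrite -[X in _ * X]powRr1 ?cmod_ge0// -powRD; last by rewrite (gt_eqF zp) implybT.
by congr (_ `^ _); ring.
Qed.

Lemma cpow0 m : cpow m 0 = 0.
Proof. by rewrite /cpow mulr0. Qed.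

Lemma cmod_cpow_le m z : 0 < m < 1 -> cmod (cpow m z) <= 1 + cmod z.
Proof.
move=> /andP[m0 m1]; have [->|z0] := eqVneq z 0; first by rewrite cpow0 cmod0 addr0.
rewrite cmod_cpow//; have [z1|z1] := leP (cmod z) 1.
  apply: (@le_trans _ _ (1 `^ m)); last by rewrite powR1 lerDl cmod_ge0.
  by rewrite ge0_ler_powR ?nnegrE ?cmod_ge0 ?(ltW m0).
apply: (@le_trans _ _ (cmod z `^ 1)); first by rewrite ler_powR ?(ltW z1) ?(ltW m1).
by rewrite powRr1 ?cmod_ge0// lerDr.
Qed.

Lemma mul_conj z : z * conjc z = ((cmod z ^+ 2)%:C)%C.
Proof. by apply: eqc; rewrite !cReImE/= ?cmod_sqr; ring. Qed.

Lemma conjc_cut (c : R[i]) (r : R) z :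
  conjc (c * (r%:C%C * z)) = conjc c * (r%:C%C * conjc z).
Proof. by apply: eqc; rewrite !cReImE/=; ring. Qed.

Lemma conjc_cutD (c : R[i]) (r s : R) z w :
  conjc (c * (r%:C%C * z + s%:C%C * w)) = conjc c * (r%:C%C * conjc z + s%:C%C * conjc w).
Proof. by apply: eqc; rewrite !cReImE/=; ring. Qed.

(** The nonlinear term tested with [u] is the density of the L^(m+1) norm. *)
Lemma cpow_conj m z : 0 < m < 1 -> cpow m z * conjc z = ((cmod z `^ (m + 1))%:C)%C.
Proof.
move=> /andP[m0 m1]; have [->|z0] := eqVneq z 0.
  by rewrite cpow0 mul0r cmod0 powR0// gt_eqF// addr_gt0.
have zp : 0 < cmod z.
  by rewrite lt_def cmod_ge0 andbT; apply: contra_neq z0; exact: cmod_eq0.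
rewrite /cpow -mulrA mul_conj -rmorphM/=; congr (_%:C)%C.
rewrite -powR_mulrn ?cmod_ge0// -powRD; last by rewrite (gt_eqF zp) implybT.
by congr (_ `^ _); ring.
Qed.

Lemma cmeasurable_cpow N (Omega : set 'rV[R]_N) m (u : 'rV[R]_N -> R[i]) :
  cmeasurable Omega u -> cmeasurable Omega (fun x => cpow m (u x)).
Proof.
move=> mu; apply: cmeasurableM => //; apply: cmeasurable_real.
by apply: (measurableT_comp (measurable_powR _)); exact: measurable_cmod.
Qed.

Lemma cmeasurable_nonlin N (Omega : set 'rV[R]_N) m a b (u : 'rV[R]_N -> R[i]) :
  cmeasurable Omega u -> cmeasurable Omega (fun x => nonlin m a b (u x)).
Proof.
move=> mu; under [X in cmeasurable _ X]eq_fun do rewrite nonlinE.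
apply: cmeasurableD; apply: cmeasurableM; try exact: cmeasurable_cst.
  exact: cmeasurable_cpow.
done.
Qed.

End nonlinearity.

(** * The energy identity and the a priori bound *)

Section weak_formulation.
Context {R : realType} {N : nat} (Omega : set 'rV[R]_N).
Hypothesis oOmega : open Omega.
Let mOmega : measurable Omega := open_measurable_rV oOmega.
Variables (m : R) (a b : R[i]) (F : 'rV[R]_N -> R[i]) (u : H1 Omega).
Hypothesis m01 : 0 < m < 1.
Hypothesis F2 : sqint Omega F.
Hypothesis usol : solves m a b F u.
Local Notation g := (H1_grad u).
Let u2 : sqint Omega u := (cLp2P Omega u).1 (H1_L2 u).
Let g2 i : sqint Omega (g i) := (cLp2P Omega (g i)).1 (H1_grad_L2 u i).

(** The distributional Laplacian of [u], read off the equation. *)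
Definition residual x := nonlin m a b (u x) - F x.

(** The equation in the sense of distributions, after one integration by parts:
    each second derivative of the test function is a first derivative of a test
    function, to which the definition of the weak gradient applies. *)
Lemma residual_test psi : test_fun Omega psi ->
  \sum_(i < N) cintegral Omega (fun x => g i x * cpartial i psi x) +
  cintegral Omega (fun x => residual x * psi x) = 0.
Proof.
move=> tpsi; have [w [wsum lap eqw]] := usol.
have tp i := test_fun_partial i tpsi; have tpp i := test_fun_partial i (tp i).
have := lap _ tpsi.
under eq_cintegral do rewrite mulr_sumr.
rewrite cintegral_sum//; last by move=> i; apply: cintegrable_sqM => //; exact: test_fun_sqint.
under eq_bigr do rewrite (H1_gradP u _ (tp _)).
rewrite sumrN => eqS; have [mu _] := u2; have [mF _] := F2.
have [mpsi _] := test_fun_sqint mOmega tpsi.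
have mw : cmeasurable Omega w.
  have [w1 [w2 [[m1 m1' _] [m2 m2' _] ew]]] := wsum.
  have [h1 h2] : cmeasurable Omega (fun x => w1 x + w2 x) by apply: cmeasurableD.
  by split; [move: h1|move: h2]; apply: eq_measurable_fun => x /set_mem Ox; rewrite ew.
rewrite -(opprK (\sum_(i < N) _)) eqS addrC; apply/eqP; rewrite subr_eq0; apply/eqP.
apply: ae_eq_cintegral => //.
- apply: cmeasurableM => //; apply: cmeasurableB => //; exact: cmeasurable_nonlin.
- exact: cmeasurableM.
- by apply: filterS eqw => x + Ox => /(_ Ox) eF; rewrite /residual -eF; ring.
Qed.

(** The weak form tested with the product of [chi] and the conjugate of [v], where
    [dv] stands for the gradient of [v]; [chi] and its derivatives are attached to
    the fixed functions, so that each term pairs two square-integrable functions,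
    one of which is linear in [v]. *)
Definition cut_form (chi : 'rV[R]_N -> R) (v : 'rV[R]_N -> R[i])
    (dv : 'I_N -> 'rV[R]_N -> R[i]) : R[i] :=
  \sum_(i < N)
    (cintegral Omega (fun x => (chi x)%:C%C * g i x * conjc (dv i x)) +
     cintegral Omega (fun x => ('D_('e_i) chi x)%:C%C * g i x * conjc (v x))) +
  cintegral Omega (fun x => (chi x)%:C%C * residual x * conjc (v x)).

Section cut.
Variables (chi : 'rV[R]_N -> R) (r D : R).
Hypothesis chi_smooth : smooth chi.
Hypothesis chi01 : forall x, 0 <= chi x <= 1.
Hypothesis chi_off : forall x, r < `|x| -> chi x = 0.
Hypothesis dchi_le : forall i x, `|'D_('e_i) chi x| <= D.

Let chi_meas : cmeasurable Omega (fun x => (chi x)%:C%C).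
Proof. by apply: (smooth_cmeasurable Omega) => //=; exact: smooth_cst. Qed.

Let dchi_meas i : cmeasurable Omega (fun x => ('D_('e_i) chi x)%:C%C).
Proof.
by apply: (smooth_cmeasurable Omega) => //=; [exact: smooth_partial|exact: smooth_cst].
Qed.

Let chi_bd x : cmod (chi x)%:C%C <= 1.
Proof. by rewrite cmod_real ger0_norm; case/andP: (chi01 x). Qed.

Let dchi_bd i x : cmod ('D_('e_i) chi x)%:C%C <= D.
Proof. by rewrite cmod_real. Qed.

Lemma sqint_chi f : sqint Omega f -> sqint Omega (fun x => (chi x)%:C%C * f x).
Proof. by move=> sf; apply: (sqintM_bdd mOmega sf chi_meas) => x _; exact: chi_bd. Qed.

Lemma sqint_dchi i f : sqint Omega f -> sqint Omega (fun x => ('D_('e_i) chi x)%:C%C * f x).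
Proof. by move=> sf; apply: (sqintM_bdd mOmega sf (dchi_meas i)) => x _; exact: dchi_bd. Qed.

(** Since |u|^m <= 1 + |u|, the power of [u] may fail to be square-integrable only
    because the constant 1 is not; multiplied by [chi], it is, the support of
    [chi] being bounded. *)
Lemma sqint_chi_residual : sqint Omega (fun x => (chi x)%:C%C * residual x).
Proof.
have [mu _] := u2; have [mF _] := F2.
have schi : sqint Omega (fun x => (chi x)%:C%C).
  by apply: (sqint_bdd_cube mOmega chi_meas chi_bd) => x /chi_off ->.
have spow : sqint Omega (fun x => (chi x)%:C%C * cpow m (u x)).
  have mp : cmeasurable Omega (fun x => (chi x)%:C%C * cpow m (u x)).
    by apply: cmeasurableM => //; exact: cmeasurable_cpow.
  have s1 : rintegrable Omega (fun x => 2 * cmod (chi x)%:C%C ^+ 2 + 2 * cmod (u x) ^+ 2).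
    by apply: (rintegrableD mOmega); apply: (rintegrableZ mOmega); [case: schi|case: u2].
  split=> //; apply: (rintegrable_le mOmega _ s1) => [|x _].
    by apply: measurable_funX; exact: measurable_cmod.
  rewrite ger0_norm ?sqr_ge0// cmodM.
  have c0 := cmod_ge0 (chi x)%:C%C; have c1 := chi_bd x.
  have p1 := cmod_cpow_le (u x) m01; have u0 := cmod_ge0 (u x).
  apply: (@le_trans _ _ ((cmod (chi x)%:C%C + cmod (u x)) ^+ 2)).
    rewrite lerXn2r ?nnegrE ?mulr_ge0 ?addr_ge0 ?cmod_ge0//.
    by apply: le_trans (ler_wpM2l c0 p1) _; rewrite mulrDr mulr1 lerD2l ler_piMl.
  have := sqr_ge0 (cmod (chi x)%:C%C - cmod (u x)); nra.
apply: (@sqint_eq _ _ _ (fun x => a * ((chi x)%:C%C * cpow m (u x)) +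
  (b * ((chi x)%:C%C * u x) - (chi x)%:C%C * F x))).
  by move=> x; rewrite /residual nonlinE; ring.
apply: (sqintD mOmega); first exact: (sqintZ mOmega).
apply: (sqintB mOmega); last exact: sqint_chi.
by apply: (sqintZ mOmega); exact: sqint_chi.
Qed.

Lemma cut_formB v v' dv dv' :
  sqint Omega v -> sqint Omega v' ->
  (forall i, sqint Omega (dv i)) -> (forall i, sqint Omega (dv' i)) ->
  cut_form chi (fun x => v x - v' x) (fun i x => dv i x - dv' i x) =
  cut_form chi v dv - cut_form chi v' dv'.
Proof.
move=> sv sv' sdv sdv'.
have key f p q : sqint Omega f -> sqint Omega p -> sqint Omega q ->
    cintegral Omega (fun x => f x * conjc (p x - q x)) =
    cintegral Omega (fun x => f x * conjc (p x)) - cintegral Omega (fun x => f x * conjc (q x)).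
  move=> sf sp sq; rewrite -(cintegralB mOmega).
  - by apply: eq_cintegral => x _; rewrite rmorphB mulrBr.
  - by apply: (cintegrable_sqM mOmega) => //; exact: sqint_conj.
  - by apply: (cintegrable_sqM mOmega) => //; exact: sqint_conj.
rewrite /cut_form (key _ _ _ sqint_chi_residual)//.
under eq_bigr => i _ do
  rewrite (key _ _ _ (sqint_chi (g2 i)))// (key _ _ _ (sqint_dchi i (g2 i)))//.
rewrite opprD [RHS]addrACA -sumrB; congr (_ + _).
  by apply: eq_bigr => i _; ring.
Qed.

Lemma cut_form_test phi : test_fun Omega phi ->
  cut_form chi phi (fun i => cpartial i phi) = 0.
Proof.
move=> tphi; have tc := test_fun_conj tphi; have tpsi := test_funM chi_smooth tc.
have [s1 s2 _ _] := tphi; have [c1 c2 _ _] := tc.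
have sphi := test_fun_sqint mOmega tphi.
have sdphi i := test_fun_sqint mOmega (test_fun_partial i tphi).
rewrite -[RHS](residual_test tpsi) /cut_form; congr (_ + _); last first.
  by apply: eq_cintegral => x _; ring.
apply: eq_bigr => i _; rewrite -(cintegralD mOmega).
- by apply: eq_cintegral => x _; rewrite cpartial_realM// cpartial_conj//; ring.
- by apply: (cintegrable_sqM mOmega); [exact: sqint_chi|exact: sqint_conj].
- by apply: (cintegrable_sqM mOmega); [exact: sqint_dchi|exact: sqint_conj].
Qed.

(** Continuity of the form at 0 in H^1, from Young's inequality with weight e. *)
Lemma cut_form_small : exists K : R, 0 <= K /\ forall (e : R) v dv, 0 < e ->
  sqint Omega v -> (forall i, sqint Omega (dv i)) ->
  energy Omega v <= e ^+ 2 -> (forall i, energy Omega (dv i) <= e ^+ 2) ->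
  cmod (cut_form chi v dv) <= e * K.
Proof.
pose E f := energy Omega f + 1.
exists (\sum_(i < N) (E (fun x => (chi x)%:C%C * g i x)
    + E (fun x => ('D_('e_i) chi x)%:C%C * g i x)) + E (fun x => (chi x)%:C%C * residual x)).
have E0 f : 0 <= E f by rewrite addr_ge0// energy_ge0.
split=> [|e v dv e0 sv sdv ve dve]; first by rewrite addr_ge0// sumr_ge0// => i _; rewrite addr_ge0.
have key f p : sqint Omega f -> sqint Omega p -> energy Omega p <= e ^+ 2 ->
    cmod (cintegral Omega (fun x => f x * conjc (p x))) <= e * E f.
  move=> sf sp pe; apply: le_trans (cintegral_young mOmega e0 sf (sqint_conj sp)) _.
  rewrite energy_conj /E mulrDr mulr1 lerD2l ler_pdivrMl// -expr2//.
rewrite /cut_form mulrDr mulr_sumr; apply: le_trans (cmodD_le _ _) _; apply: lerD; last first.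
  by apply: key => //; exact: sqint_chi_residual.
apply: (@le_trans _ _ (\sum_(i < N) cmod
  (cintegral Omega (fun x => (chi x)%:C%C * g i x * conjc (dv i x)) +
     cintegral Omega (fun x => ('D_('e_i) chi x)%:C%C * g i x * conjc (v x))))).
  elim/big_ind2: _ => [|x1 y1 x2 y2 h1 h2|//]; first by rewrite cmod0.
  by apply: le_trans (cmodD_le _ _) _; exact: lerD.
apply: ler_sum => i _; rewrite mulrDr; apply: le_trans (cmodD_le _ _) _; apply: lerD.
  by apply: key => //; exact: sqint_chi.
by apply: key => //; exact: sqint_dchi.
Qed.

(** The form at [u] equals the form at u - phi for every test function phi, which
    is as small as desired. *)
Lemma cut_form_dirichlet : in_H10 u -> cut_form chi u g = 0.
Proof.
move=> u0; have [K [K0 HK]] := cut_form_small.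
apply: cmod_eq0; apply/eqP; rewrite eq_le cmod_ge0 andbT.
apply/ler_addgt0Pl => e' e'0; rewrite addr0.
pose e := e' / (K + 1); have e0 : 0 < e by rewrite divr_gt0// ltr_wpDl.
have [phi tphi small] := u0 e e0.
have [s1 s2 _ _] := tphi; have tp i := test_fun_partial i tphi.
have sphi := test_fun_sqint mOmega tphi; have sdphi i := test_fun_sqint mOmega (tp i).
have sd := sqintB mOmega u2 sphi; have sdd i := sqintB mOmega (g2 i) (sdphi i).
move: small; rewrite (cLnorm2_energy mOmega sd).
under eq_bigr => i _ do rewrite (cLnorm2_energy mOmega (sdd i)).
rewrite sumEFin -EFinD lte_fin => small.
rewrite -[cut_form _ _ _]subr0 -(cut_form_test tphi) -cut_formB//.
have sum0 : 0 <= \sum_(i < N) energy Omega (fun x => g i x - cpartial i phi x).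
  by apply: sumr_ge0 => i _; exact: energy_ge0.
have en0 := energy_ge0 Omega (fun x => u x - phi x).
apply: (@le_trans _ _ (e * K)).
  apply: HK => //; first by apply: ltW; apply: le_lt_trans small; rewrite lerDl.
  move=> i; apply: ltW; apply: le_lt_trans small; apply: ler_wpDl => //.
  rewrite (bigD1 i)//= lerDl; apply: sumr_ge0 => j _; exact: energy_ge0.
rewrite /e mulrAC ler_pdivrMr ?ltr_wpDl// ler_wpM2l ?(ltW e'0)//.
by rewrite lerDl.
Qed.

(** Leibniz rule for weak derivatives: the product of [chi] with a test function
    is again a test function. *)
Lemma weak_partial_cut (c : R[i]) i : weak_partial Omega i
  (fun x => c * ((chi x)%:C%C * u x))
  (fun x => c * ((chi x)%:C%C * g i x + ('D_('e_i) chi x)%:C%C * u x)).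
Proof.
move=> phi tphi; have [s1 s2 _ _] := tphi.
have tpsi := test_funM chi_smooth tphi.
have sphi := test_fun_sqint mOmega tphi.
have spsi := test_fun_sqint mOmega tpsi.
have sdpsi := test_fun_sqint mOmega (test_fun_partial i tpsi).
have i1 := cintegrable_sqM mOmega u2 sdpsi.
have i2 := cintegrable_sqM mOmega (sqint_dchi i u2) sphi.
have i3 := cintegrable_sqM mOmega (g2 i) spsi.
transitivity (cintegral Omega (fun x => c * (u x * cpartial i (fun x => (chi x)%:C%C * phi x) x
     - ('D_('e_i) chi x)%:C%C * u x * phi x))).
  by apply: eq_cintegral => x _; rewrite cpartial_realM//; ring.
rewrite (cintegralZ mOmega); last exact: (cintegrableB mOmega).
rewrite (cintegralB mOmega)// (H1_gradP u i tpsi) -opprD -(cintegralD mOmega)//.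
rewrite mulrN -(cintegralZ mOmega); last exact: (cintegrableD mOmega).
by congr (- _); apply: eq_cintegral => x _; ring.
Qed.

Definition cut_H1 (c : R[i]) : H1 Omega :=
  @MkH1 R N Omega _ _
   ((cLp2P Omega _).2 (sqintZ mOmega c (sqint_chi u2)))
   (fun i => (cLp2P Omega _).2 (sqintZ mOmega c
      (sqintD mOmega (sqint_chi (g2 i)) (sqint_dchi i u2))))
   (weak_partial_cut c).

(** The Neumann condition only controls real parts; the variations chi u and
    i chi u give the real and the imaginary part of the form. *)
Lemma cut_form_neumann : neumann m a b F u -> cut_form chi u g = 0.
Proof.
move=> nu.
have key c : complex.Re (conjc c * cut_form chi u g) = 0.
  have off : exists r : R, forall x, Omega x -> r < `|x| -> cut_H1 c x = 0.
    by exists r => x _ /chi_off /= ->; rewrite mul0r mulr0.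
  have := nu (cut_H1 c) off.
  have ig i := cintegrable_sqM mOmega (sqint_chi (g2 i)) (sqint_conj (g2 i)).
  have idg i := cintegrable_sqM mOmega (sqint_dchi i (g2 i)) (sqint_conj u2).
  have ir := cintegrable_sqM mOmega sqint_chi_residual (sqint_conj u2).
  have iF := cintegrable_sqM mOmega F2 (sqint_conj (sqintZ mOmega c (sqint_chi u2))).
  have -> : cintegral Omega (fun x => \sum_(i < N) g i x * conjc (H1_grad (cut_H1 c) i x)) =
    conjc c * \sum_(i < N)
      (cintegral Omega (fun x => (chi x)%:C%C * g i x * conjc (g i x)) +
       cintegral Omega (fun x => ('D_('e_i) chi x)%:C%C * g i x * conjc (u x))).
    under [in RHS]eq_bigr => i _ do rewrite -(cintegralD mOmega)//.
    rewrite -(cintegral_sum mOmega); last by move=> i; exact: (cintegrableD mOmega).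
    rewrite -(cintegralZ mOmega); last first.
      by apply: (cintegrable_sum mOmega) => i; exact: (cintegrableD mOmega).
    apply: eq_cintegral => x _; rewrite mulr_sumr; apply: eq_bigr => i _.
    by rewrite /= conjc_cutD; ring.
  have -> : cintegral Omega (fun x => nonlin m a b (u x) * conjc (cut_H1 c x)) =
    conjc c * cintegral Omega (fun x => (chi x)%:C%C * residual x * conjc (u x)) +
    cintegral Omega (fun x => F x * conjc (cut_H1 c x)).
    rewrite -(cintegralZ mOmega)// -(cintegralD mOmega)//; last exact: (cintegrableZ mOmega).
    apply: eq_cintegral => x _.
    by rewrite /= conjc_cut /residual; ring.
  by rewrite cReD addrA => /eqP; rewrite -subr_eq0 addrK -cReD -mulrDr => /eqP.
apply: eqc.
  by have := key 1; rewrite conjc1 mul1r.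
by have := key 'i%C; rewrite cReM/= mul0r sub0r mulN1r opprK.
Qed.

End cut.

Section limit.
Hypothesis um : cLp Omega (m + 1) u.
Hypothesis cut0 : forall n, cut_form (cutoff n.+1%:R^-1) u g = 0.
Local Notation mu := (lebesgue_rV N : measure _ R).

Let m10 : 0 < m + 1. Proof. by case/andP: m01 => m0 _; rewrite addr_gt0. Qed.

Let up : rintegrable Omega (fun x => cmod (u x) `^ (m + 1)).
Proof. by have [_] := (cLpP Omega u m10).1 um. Qed.

Lemma cutoff_Rintegral_cvg (h : 'rV[R]_N -> R) : rintegrable Omega h ->
  \int[mu]_(x in Omega) (cutoff n.+1%:R^-1 x * h x) @[n --> \oo] -->
  \int[mu]_(x in Omega) h x.
Proof.
move=> ih; have mh := rintegrable_measurable ih.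
have mc n : measurable_fun Omega (fun x => cutoff n.+1%:R^-1 x * h x).
  apply: measurable_funM => //; apply: measurable_funTS.
  by apply: continuous_measurable_rV; apply: smooth_continuous; exact: cutoff_smooth.
have := @dominated_convergence _ _ _ mu _ mOmega
  (fun n x => (cutoff n.+1%:R^-1 x * h x)%:E) (EFin \o h) (EFin \o (Num.norm \o h)).
case.
- by move=> n; exact/measurable_EFinP.
- exact/measurable_EFinP.
- apply: aeW => x Ox; apply: cvg_EFin; first exact: nearW.
  rewrite -[X in _ --> X]mul1r; apply: cvgMl; exact: cutoff_cvg.
- exact: integrable_norm.
- apply: aeW => x n Ox; rewrite /= lee_fin normrM ler_piMl//.
  by have /andP[c0 c1] := cutoff_itv n.+1%:R^-1 x; rewrite ger0_norm.
have eI : (\int[mu]_(x in Omega) (EFin \o h) x)%E = (\int[mu]_(x in Omega) h x)%:E.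
  exact: (rintegral_fin mOmega ih).
by rewrite eI => _ _ /fine_cvgP[_].
Qed.

(** Its integral is X + a Y + b Z minus the pairing of F with u. *)
Definition energy_density x : R[i] :=
  \sum_(i < N) g i x * conjc (g i x) + a * (cpow m (u x) * conjc (u x)) +
  b * (u x * conjc (u x)) - F x * conjc (u x).

Let igg i := cintegrable_sqM mOmega (g2 i) (sqint_conj (g2 i)).
Let iuu := cintegrable_sqM mOmega u2 (sqint_conj u2).
Let iFu := cintegrable_sqM mOmega F2 (sqint_conj u2).

Let cintegrable_real (h : 'rV[R]_N -> R) : rintegrable Omega h ->
  cintegrable Omega (fun x => (h x)%:C%C).
Proof. by move=> ih; split => //=; exact: integrable0. Qed.

Let cintegral_real (h : 'rV[R]_N -> R) :
  cintegral Omega (fun x => (h x)%:C%C) = ((\int[mu]_(x in Omega) h x)%:C)%C.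
Proof. by apply: eqc => //=; rewrite Rintegral_cst// mul0r. Qed.

Let ipu : cintegrable Omega (fun x => cpow m (u x) * conjc (u x)).
Proof.
by apply: (cintegrable_eq mOmega _ (cintegrable_real up)) => x _; rewrite cpow_conj.
Qed.

Let ipart : cintegrable Omega (fun x => \sum_(i < N) g i x * conjc (g i x) +
  a * (cpow m (u x) * conjc (u x)) + b * (u x * conjc (u x))).
Proof.
apply: (cintegrableD mOmega); last exact: (cintegrableZ mOmega).
apply: (cintegrableD mOmega); last exact: (cintegrableZ mOmega).
exact: (cintegrable_sum mOmega).
Qed.

Let iH : cintegrable Omega energy_density.
Proof. exact: (cintegrableB mOmega). Qed.

Lemma energy_densityE : cintegral Omega energy_density =
  ((\sum_(i < N) energy Omega (g i))%:C)%C +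
  a * ((\int[mu]_(x in Omega) (cmod (u x) `^ (m + 1)))%:C)%C +
  b * ((energy Omega u)%:C)%C - cintegral Omega (fun x => F x * conjc (u x)).
Proof.
have sqE f : cintegral Omega (fun x => f x * conjc (f x)) = ((energy Omega f)%:C)%C.
  by rewrite -cintegral_real; apply: eq_cintegral => x _; rewrite mul_conj.
rewrite (cintegralB mOmega)//; congr (_ - _).
rewrite (cintegralD mOmega)//; last exact: (cintegrableZ mOmega).
  rewrite (cintegralZ mOmega)// sqE; congr (_ + _).
  rewrite (cintegralD mOmega)//; last exact: (cintegrableZ mOmega).
    rewrite (cintegral_sum mOmega)// (cintegralZ mOmega)// -cintegral_real rmorph_sum/=.
    congr (_ + a * _); first by apply: eq_bigr => i _; rewrite sqE.
    by apply: eq_cintegral => x _; rewrite cpow_conj.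
  exact: (cintegrable_sum mOmega).
apply: (cintegrableD mOmega); last exact: (cintegrableZ mOmega).
exact: (cintegrable_sum mOmega).
Qed.

(** Since the form vanishes at [u], the cut-off energy density integrates to the
    terms with the gradient of the cut-off, which are O(s). *)
Lemma cut_density_small : exists K : R, 0 <= K /\ forall n,
  cmod (cintegral Omega (fun x => (cutoff n.+1%:R^-1 x)%:C%C * energy_density x)) <=
    K * n.+1%:R^-1.
Proof.
have [C [C0 HC]] := @cutoff_partial_bound R.
pose k i := \int[mu]_(x in Omega) cmod (g i x * conjc (u x)).
have igu i := cintegrable_sqM mOmega (g2 i) (sqint_conj u2).
have k0 i : 0 <= k i by apply: Rintegral_ge0 => x _; exact: cmod_ge0.
exists (\sum_(i < N) 2 * (C * k i)); split=> [|n].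
  by apply: sumr_ge0 => i _; rewrite !mulr_ge0.
set s : R := n.+1%:R^-1; have s0 : 0 < s by rewrite invr_gt0.
pose chi := @cutoff R N s.
have sm : smooth chi := cutoff_smooth s.
have schi f : sqint Omega f -> sqint Omega (fun x => (chi x)%:C%C * f x).
  by apply: sqint_chi => // x; exact: cutoff_itv.
have sdchi i f : sqint Omega f -> sqint Omega (fun x => ('D_('e_i) chi x)%:C%C * f x).
  by apply: (@sqint_dchi chi (C * s)) => // j x; exact: HC.
have sr : sqint Omega (fun x => (chi x)%:C%C * residual x).
  apply: (@sqint_chi_residual chi s^-1) => // x; first exact: cutoff_itv.
  exact: cutoff_eq0.
have ig i := cintegrable_sqM mOmega (schi _ (g2 i)) (sqint_conj (g2 i)).
have idg i := cintegrable_sqM mOmega (sdchi i _ (g2 i)) (sqint_conj u2).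
have ir := cintegrable_sqM mOmega sr (sqint_conj u2).
have e1 : cintegral Omega (fun x => (chi x)%:C%C * energy_density x) =
  - \sum_(i < N) cintegral Omega (fun x => ('D_('e_i) chi x)%:C%C * g i x * conjc (u x)).
  apply/eqP; rewrite -subr_eq0 opprK; apply/eqP; rewrite -[RHS](cut0 n) /cut_form.
  rewrite big_split/= addrAC; congr (_ + _).
  rewrite -(cintegral_sum mOmega)// -(cintegralD mOmega)//; last exact: (cintegrable_sum mOmega).
  apply: eq_cintegral => x _; rewrite /energy_density /residual nonlinE.
  under [in RHS]eq_bigr => i _ do rewrite -mulrA.
  by rewrite -mulr_sumr; ring.
rewrite e1 cmodN mulr_suml.
elim/big_ind2: _ => [|x1 y1 x2 y2 h1 h2|i _]; first by rewrite cmod0.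
  by apply: le_trans (cmodD_le _ _) _; exact: lerD.
have hi : rintegrable Omega (fun x => C * s * cmod (g i x * conjc (u x))).
  by apply: (rintegrableZ mOmega); exact: (rintegrable_cmod mOmega).
apply: le_trans (cmod_cintegral_le mOmega (idg i) hi _) _ => [x _|].
  by rewrite -mulrA cmodM cmod_real ler_wpM2r ?cmod_ge0//; exact: HC.
rewrite RintegralZl//; last exact: (rintegrable_cmod mOmega).
by rewrite -/(k i) le_eqVlt; apply/orP; left; apply/eqP; ring.
Qed.

Lemma energy_identity : cintegral Omega energy_density = 0.
Proof.
have [K [K0 HK]] := cut_density_small.
have [iRe iIm] := iH.
have lim0 (h : 'rV[R]_N -> R) : rintegrable Omega h ->
    (forall n, `|\int[mu]_(x in Omega) (cutoff n.+1%:R^-1 x * h x)| <= K * n.+1%:R^-1) ->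
    \int[mu]_(x in Omega) h x = 0.
  move=> ih hh; have c1 := cutoff_Rintegral_cvg ih.
  have c2 : \int[mu]_(x in Omega) (cutoff n.+1%:R^-1 x * h x) @[n --> \oo] --> (0 : R).
    apply/norm_cvg0P; apply: (@squeeze_cvgr _ _ _ _ (fun=> 0) (fun n => K * n.+1%:R^-1)).
    - by apply: nearW => n; rewrite normr_ge0 hh.
    - exact: cvg_cst.
    - by rewrite -[X in _ --> X](mulr0 K); apply: cvgMr; exact: cvg_harmonic.
  exact: (cvg_unique _ c1 c2).
apply: eqc => /=; apply: lim0 => // n.
  apply: le_trans (HK n); apply: le_trans (normRe_le _) => /=.
  by under [X in _ <= `|X|]eq_Rintegral do rewrite Re_realM.
apply: le_trans (HK n); apply: le_trans (normIm_le _) => /=.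
by under [X in _ <= `|X|]eq_Rintegral do rewrite Im_realM.
Qed.

(** The gap bounds d (X + Y + Z) by the pairing of F with u; Young's inequality
    with weight 2 / d absorbs half of it into the left-hand side. *)
Lemma apriori_bound : admissible a b ->
  \sum_(i < N) energy Omega (g i) + \int[mu]_(x in Omega) (cmod (u x) `^ (m + 1)) +
    energy Omega u <= 4 / hull_gap a b ^+ 2 * energy Omega F.
Proof.
move=> /hull_gap_gt0 d0; set d := hull_gap a b in d0 *.
have := energy_identity; rewrite energy_densityE => /eqP.
rewrite subr_eq0 => /eqP eF.
set X := \sum_(i < N) _ in eF *; set Y := (X in a * X%:C%C) in eF *.
set Z := energy Omega u in eF *.
have X0 : 0 <= X by apply: sumr_ge0 => i _; exact: energy_ge0.
have Y0 : 0 <= Y by apply: Rintegral_ge0 => x _; exact: powR_ge0.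
have Z0 : 0 <= Z by exact: energy_ge0.
have := hull_gapP a b X0 Y0 Z0; rewrite eF -/d => gap.
have e0 : 0 < 2 / d by rewrite divr_gt0.
have := cintegral_young mOmega e0 F2 (sqint_conj u2).
rewrite energy_conj -/Z invf_div => /(le_trans gap) {}gap.
have {}gap : d * (X + Y + Z) <= 2 * (2 / d * energy Omega F).
  have : d / 2 * Z <= d / 2 * (X + Y + Z) by rewrite ler_wpM2l ?divr_ge0 ?(ltW d0)//; lra.
  lra.
rewrite -(ler_pM2l d0); apply: le_trans gap _; rewrite le_eqVlt; apply/orP; left; apply/eqP.
by field; rewrite gt_eqF.
Qed.

End limit.
End weak_formulation.

Lemma H1_norm_sqr (R : realType) (N : nat) (Omega : set 'rV[R]_N) (u : H1 Omega) :
  measurable Omega ->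
  (H1_norm u ^+ 2 = (energy Omega u + \sum_(i < N) energy Omega (H1_grad u i))%:E)%E.
Proof.
move=> mOmega; have u2 := (cLp2P Omega u).1 (H1_L2 u).
have g2 i := (cLp2P Omega (H1_grad u i)).1 (H1_grad_L2 u i).
rewrite /H1_norm (cLnorm2_energy mOmega u2).
under eq_bigr => i _ do rewrite (cLnorm2_energy mOmega (g2 i)).
rewrite sumEFin -EFinD -poweR2 ?poweR_ge0// -poweRrM mulVf// poweRe1// lee_fin.
by rewrite addr_ge0 ?energy_ge0// sumr_ge0// => i _; exact: energy_ge0.
Qed.

(* M is uniform in N, Omega, m, F and u, and is a continuous function of (a, b).
   It cannot be a function of the moduli of a and b alone: if u0 is a nonzero
   solution of - u0'' = |u0|^(m-1) u0 + u0 in H^1_0 of a bounded interval, then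
   for |a| = |b| = 1 and a = b --> -1 with Im a > 0, the right-hand side of the
   equation solved by u0 tends to 0 in L^2. The alias R[i]^o carries the usual
   topology of the complex numbers. *)
Theorem theorem2p9 (R : realType) :
  exists M : R[i]^o * R[i]^o -> R,
    [/\ forall a b, admissible a b -> 0 < M (a, b),
        {within [set p : R[i]^o * R[i]^o | admissible p.1 p.2], continuous M} &
        forall (N : nat) (Omega : set 'rV[R]_N) (m : R) (a b : R[i])
               (F : 'rV[R]_N -> R[i]) (u : H1 Omega),
          (0 < N)%N -> open Omega -> Omega !=set0 ->
          0 < m < 1 -> admissible a b ->
          cLp Omega 2 F -> cLp Omega (m + 1) u ->
          solves m a b F u ->
          in_H10 u \/ (C1_boundary Omega /\ neumann m a b F u) ->
          (H1_norm u ^+ 2 + cLnorm Omega (m + 1)%R u `^ (m + 1)%R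
             <= (M (a, b))%:E * cLnorm Omega 2 F ^+ 2)%E].
Proof.
exists (fun p => 4 / hull_gap p.1 p.2 ^+ 2); split.
- by move=> a b /hull_gap_gt0 d0; rewrite divr_gt0// exprn_gt0.
- exact: gap_constant_continuous.
move=> N Omega m a b F u _ oOmega _ m01 adm FL2 um sol bc.
have mOmega := open_measurable_rV oOmega.
have F2 := (cLp2P Omega F).1 FL2.
have [C [C0 HC]] := @cutoff_partial_bound R.
have cut0 n : cut_form m a b F u (cutoff n.+1%:R^-1) u (H1_grad u) = 0.
  have s0 : 0 < n.+1%:R^-1 :> R by rewrite invr_gt0.
  have off (x : 'rV[R]_N) : n.+1%:R^-1^-1 < `|x| -> cutoff n.+1%:R^-1 x = 0.
    exact: cutoff_eq0.
  have db i (x : 'rV[R]_N) := HC N _ x i s0.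
  case: bc => [u0|[_ nu]].
    exact: (cut_form_dirichlet oOmega m01 F2 sol (cutoff_smooth _) (cutoff_itv _) off db u0).
  exact: (cut_form_neumann oOmega m01 F2 (cutoff_smooth _) (cutoff_itv _) off db nu).
have m10 : 0 < m + 1 by case/andP: m01 => m0 _; rewrite addr_gt0.
have [_ up] := (cLpP Omega u m10).1 um.
rewrite (H1_norm_sqr u mOmega) (cLnorm_pow Omega u m10) (rintegral_fin mOmega up).
rewrite (cLnorm2_energy mOmega F2) -EFinD -EFinM lee_fin.
have := apriori_bound oOmega m01 F2 um cut0 adm.
by rewrite addrC addrA [X in X + _]addrC.
Qed.
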